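(* Let $G$ be a finite group, let $U$ be a projective unitary representation of $G$ on a finite-dimensional Hilbert space $\mathcal{H}$, let $H$ be a $G$-invariant Hamiltonian on $\mathcal{H}$ (i.e. $H$ is Hermitian and $[U(g),H]=0$ for all $g\in G$), and let $\rho$ be a state on $\mathcal{H}$. Then $$\overline{W}^{(\infty)}_{G\text{-}\mathrm{inv}}(\rho)=\overline{W}^{(\infty)}(\rho).$$
   Context: Let $H^{\times n}:=\sum_{j=1}^nI^{\otimes j-1}\otimes H\otimes I^{\otimes n-j}$. Define $W^{(n)}(\rho):=\max_V\{\mathrm{tr}(\rho^{\otimes n}H^{\times n})-\mathrm{tr}(V\rho^{\otimes n}V^\dagger H^{\times n})\}$, the maximum being over all unitaries $V$ on $\mathcal{H}^{\otimes n}$, and $W^{(n)}_{G\text{-}\mathrm{inv}}(\rho)$ by the same formula with the maximum restricted to unitaries satisfying $[V,U(g)^{\otimes n}]=0$ for all $g\in G$ (the unitaries are not required to commute with the Hamiltonian). Then $\overline{W}^{(\infty)}(\rho):=\limsup_{n\to\infty}\frac1nW^{(n)}(\rho)$ and $\overline{W}^{(\infty)}_{G\text{-}\mathrm{inv}}(\rho):=\limsup_{n\to\infty}\frac1nW^{(n)}_{G\text{-}\mathrm{inv}}(\rho)$. *)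

(* Defs.v *)
From HB Require Import structures.
From mathcomp Require Import all_boot all_order all_algebra all_fingroup.
From mathcomp Require Import all_classical all_reals all_analysis.
From mathcomp Require Import spectral.
From mathcomp.real_closed Require Import complex mxtens.

Set Implicit Arguments.
Unset Strict Implicit.
Unset Printing Implicit Defensive.

Import Order.TTheory GRing.Theory Num.Theory numFieldNormedType.Exports.
Local Open Scope ring_scope.
Local Open Scope classical_set_scope.
Local Open Scope sesquilinear_scope.

(* The Hilbert space is C^d, with C := R[i] for a realType R. Vectors are rows,
   so that u *m A *m u ^t* is the sesquilinear form of A on u. *)

Definition density_matrix (R : realType) (d : nat) (rho : 'M[R[i]]_d) : Prop :=
  [/\ rho \is hermsymmx,
      forall u : 'rV[R[i]]_d, 0 <= (u *m rho *m u ^t*) 0 0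
    & \tr rho = 1].

Definition projective_unitary_rep (R : realType) (d : nat) (G : finGroupType)
    (U : G -> 'M[R[i]]_d) : Prop :=
  (forall g, U g \is unitarymx) /\
  exists omega : G -> G -> R[i], forall g h,
    `|omega g h| = 1 /\ U g *m U h = omega g h *: U (g * h)%g.

Section WorkExtraction.
Variables (R : realType) (d : nat).
Local Notation C := R[i].
Implicit Types rho H : 'M[C]_d.

Lemma site_dim (n : nat) (j : 'I_n) :
  (d ^ j * d * d ^ (n - j.+1) = d ^ n)%N.
Proof. by rewrite -expnSr -expnD subnKC. Qed.

(* Sites are numbered from 0. The cast identifies the dimension of the Kronecker
   product of a site operator with identities, d^j * d * d^(n-j-1), with d^n. *)
Definition total_hamiltonian (n : nat) H : 'M[C]_(d ^ n) :=
  \sum_(j < n)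
    castmx (site_dim j, site_dim j)
      (tensmx (tensmx (ntensmx 1%:M j) H) (ntensmx 1%:M (n - j.+1))).

(* Both traces are real when rho and H are Hermitian; complex.Re only changes
   the type of the result. *)
Definition extracted_work (n : nat) rho H (V : 'M[C]_(d ^ n)) : R :=
  complex.Re (\tr (ntensmx rho n *m total_hamiltonian n H)
              - \tr (V *m ntensmx rho n *m V ^t* *m total_hamiltonian n H)).

(* A maximum: max_work_attained and max_work_inv_attained below show that the
   suprema over these compact sets of unitaries are attained. *)
Definition max_work (n : nat) rho H : R :=
  sup [set extracted_work rho H V | V in [set V : 'M[C]_(d ^ n) | V \is unitarymx]].

Definition max_work_inv (G : finGroupType) (U : G -> 'M[C]_d) (n : nat)
    rho H : R :=
  sup [set extracted_work rho H V | V in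
        [set V : 'M[C]_(d ^ n) |
          V \is unitarymx /\ forall g, comm_mx V (ntensmx (U g) n)]].

Definition asymptotic_work rho H : \bar R :=
  limn_esup (fun n => (n%:R^-1 * max_work n rho H)%:E).

Definition asymptotic_work_inv (G : finGroupType) (U : G -> 'M[C]_d)
    rho H : \bar R :=
  limn_esup (fun n => (n%:R^-1 * max_work_inv U n rho H)%:E).

End WorkExtraction.

Section Attained.
Variables (R : realType).
Local Notation C := R[i].

Section Cont.
Variable T : topologicalType.

Definition ccont (f : T -> C) :=
  continuous (fun x => complex.Re (f x)) /\ continuous (fun x => complex.Im (f x)).

Lemma ccont_cst c : ccont (fun=> c).
Proof. by split=> x; exact: cvg_cst. Qed.

Lemma ccontD f g : ccont f -> ccont g -> ccont (fun x => f x + g x).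
Proof.
move=> [f1 f2] [g1 g2]; split=> x.
- have -> : (fun x => complex.Re (f x + g x))
    = (fun x => complex.Re (f x) + complex.Re (g x)).
    by apply/funext => y; case: (f y) => ? ?; case: (g y).
  by apply: cvgD; [exact: f1 | exact: g1].
- have -> : (fun x => complex.Im (f x + g x))
    = (fun x => complex.Im (f x) + complex.Im (g x)).
    by apply/funext => y; case: (f y) => ? ?; case: (g y).
  by apply: cvgD; [exact: f2 | exact: g2].
Qed.

Lemma ccontM f g : ccont f -> ccont g -> ccont (fun x => f x * g x).
Proof.
move=> [f1 f2] [g1 g2]; split=> x.
- have -> : (fun x => complex.Re (f x * g x))
    = (fun x => complex.Re (f x) * complex.Re (g x) - complex.Im (f x) * complex.Im (g x)).
    by apply/funext => y; case: (f y) => ? ?; case: (g y).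
  by apply: cvgB; apply: cvgM; [exact: f1 | exact: g1 | exact: f2 | exact: g2].
- have -> : (fun x => complex.Im (f x * g x))
    = (fun x => complex.Re (f x) * complex.Im (g x) + complex.Im (f x) * complex.Re (g x)).
    by apply/funext => y; case: (f y) => ? ?; case: (g y).
  by apply: cvgD; apply: cvgM; [exact: f1 | exact: g2 | exact: f2 | exact: g1].
Qed.

Lemma ccont_conj f : ccont f -> ccont (fun x => (f x)^*).
Proof.
move=> [f1 f2]; split=> x.
- have -> : (fun x => complex.Re (f x)^*) = (fun x => complex.Re (f x)).
    by apply/funext => y; case: (f y).
  exact: f1.
- have -> : (fun x => complex.Im (f x)^*) = (fun x => - complex.Im (f x)).
    by apply/funext => y; case: (f y).
  by apply: cvgN; exact: f2.
Qed.

Lemma ccont_sum (I : Type) (r : seq I) (F : I -> T -> C) :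
  (forall i, ccont (F i)) -> ccont (fun x => \sum_(i <- r) F i x).
Proof.
move=> cF; elim: r => [|i r ih].
  rewrite (_ : (fun _ => _) = fun=> 0); first exact: ccont_cst.
  by apply/funext => x; rewrite big_nil.
rewrite (_ : (fun _ => _) = fun x => F i x + \sum_(i <- r) F i x).
  by apply: ccontD.
by apply/funext => x; rewrite big_cons.
Qed.

Definition mcont m n (A : T -> 'M[C]_(m, n)) := forall i j, ccont (fun x => A x i j).

Lemma mcont_cst m n (A : 'M[C]_(m, n)) : mcont (fun=> A).
Proof. by move=> i j; exact: ccont_cst. Qed.

Lemma mcontM m n p (A : T -> 'M[C]_(m, n)) (B : T -> 'M[C]_(n, p)) :
  mcont A -> mcont B -> mcont (fun x => A x *m B x).
Proof.
move=> cA cB i j.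
rewrite (_ : (fun _ => _) = fun x => \sum_k A x i k * B x k j).
  by apply: ccont_sum => k; apply: ccontM.
by apply/funext => x; rewrite mxE.
Qed.

Lemma mcont_adj m n (A : T -> 'M[C]_(m, n)) : mcont A -> mcont (fun x => A x ^t*).
Proof.
move=> cA i j; rewrite (_ : (fun _ => _) = fun x => (A x j i)^*).
  exact: ccont_conj.
by apply/funext => x; rewrite !mxE.
Qed.

Lemma closed_ccont_eq f (c : C) : ccont f -> closed [set x | f x = c].
Proof.
move=> [f1 f2].
rewrite (_ : [set _ | _] = (fun x => complex.Re (f x)) @^-1` [set complex.Re c]
   `&` (fun x => complex.Im (f x)) @^-1` [set complex.Im c]).
  by apply: closedI; apply: preimage_closed => //; first [move=> ? _; by [apply: f1|apply: f2]|exact: closed_eq].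
apply/seteqP; split=> x /=; first by move=> ->.
by case: (f x) => a b; case: c => a' b' /= [-> ->].
Qed.

Lemma closed_mcont_eq m n (A B : T -> 'M[C]_(m, n)) :
  mcont A -> mcont B -> closed [set x | A x = B x].
Proof.
move=> cA cB.
rewrite (_ : [set _ | _] = \bigcap_(ij in setT) [set x | A x ij.1 ij.2 + -1 * B x ij.1 ij.2 = 0]).
  apply: closed_bigI => -[i j] _; apply: closed_ccont_eq.
  by apply: ccontD => //; apply: ccontM => //; exact: ccont_cst.
apply/seteqP; split=> [x /= e ij _|x /= h]; first by rewrite /= e mulN1r subrr.
apply/matrixP => i j; have := h (i, j) I => /= /eqP.
by rewrite mulN1r subr_eq0 => /eqP.
Qed.

Lemma mcont_tr n (A : T -> 'M[C]_n) : mcont A -> ccont (fun x => \tr (A x)).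
Proof. by move=> cA; rewrite /mxtrace; apply: ccont_sum. Qed.
End Cont.

Definition mx_of_rV N (w : 'rV[R]_(N * N + N * N)) : 'M[C]_N :=
  \matrix_(i, j) Complex (lsubmx w 0 (mxvec_index i j)) (rsubmx w 0 (mxvec_index i j)).

Lemma mx_of_rV_cont N : mcont (@mx_of_rV N).
Proof.
move=> i j; split.
- rewrite (_ : (fun _ => _) = fun w : 'rV_(N * N + N * N) => w 0 (lshift _ (mxvec_index i j))).
    exact: coord_continuous.
  by apply/funext => w; rewrite !mxE.
- rewrite (_ : (fun _ => _) = fun w : 'rV_(N * N + N * N) => w 0 (rshift _ (mxvec_index i j))).
    exact: coord_continuous.
  by apply/funext => w; rewrite !mxE.
Qed.

Lemma mx_of_rV_surj N (V : 'M[C]_N) : exists w, mx_of_rV w = V.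
Proof.
exists (row_mx (mxvec (\matrix_(i, j) complex.Re (V i j)))
               (mxvec (\matrix_(i, j) complex.Im (V i j)))).
apply/matrixP => i j; rewrite mxE row_mxKl row_mxKr !mxvecE !mxE.
by case: (V i j).
Qed.

Lemma unitarymx_le1 N (V : 'M[C]_N) i j : V \is unitarymx -> `|V i j| <= 1.
Proof.
move=> /unitarymxP /matrixP /(_ i i); rewrite !mxE eqxx => h.
have {}h : \sum_k `|V i k| ^+ 2 = 1.
  by rewrite -[RHS]h; apply: eq_bigr => k _; rewrite !mxE normCK.
rewrite -(@ler_pXn2r _ 2) ?nnegrE // expr1n -h (bigD1 j) //=.
by rewrite lerDl; apply: sumr_ge0 => k _; exact: exprn_ge0.
Qed.

Lemma ReIm_le1 (z : C) : `|z| <= 1 -> `|complex.Re z| <= 1 /\ `|complex.Im z| <= 1.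
Proof.
move=> h; have := add_Re2_Im2 z => e.
have : complex.Re z ^+ 2 + complex.Im z ^+ 2 <= 1.
  by rewrite -lecR e -[1%:C%C]/(1 : C) exprn_ile1.
by move=> le1; split; rewrite -(@ler_pXn2r _ 2) ?nnegrE // expr1n real_normK ?num_real //;
  apply: le_trans le1; rewrite ?lerDl ?lerDr sqr_ge0.
Qed.

Lemma compact_unitary_commutant N (T : Type) (B : T -> 'M[C]_N) :
  compact [set w | mx_of_rV w \is unitarymx /\ forall t, comm_mx (mx_of_rV w) (B t)].
Proof.
apply: bounded_closed_compact.
  exists 1; split; first exact: num_real.
  move=> M M1 w /= [u _].
  rewrite [leLHS]/Num.norm /= mx_normrE; apply/bigmax_leP; split; first exact: le_trans (ltW M1).
  move=> [k l] _ /=; rewrite ord1; apply: le_trans (ltW M1).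
  case: (split_ordP l) => m ->; case/mxvec_indexP: m => i j;
   have [] := ReIm_le1 (unitarymx_le1 i j u); rewrite !mxE //=.
rewrite (_ : [set _ | _] = [set w | mx_of_rV w *m (mx_of_rV w)^t* = 1%:M] `&`
  \bigcap_(t in setT) [set w | mx_of_rV w *m B t = B t *m mx_of_rV w]); last first.
  apply/seteqP; split=> w /=.
    by move=> [/unitarymxP ? h]; split=> // t _; exact: h.
  by move=> [/unitarymxP ? h]; split=> // t; exact: h.
have c := @mx_of_rV_cont N.
apply: closedI.
  apply: closed_mcont_eq; last exact: mcont_cst.
  by apply: mcontM => //; exact: mcont_adj.
apply: closed_bigI => t _.
by apply: closed_mcont_eq; apply: mcontM => //; exact: mcont_cst.
Qed.

Lemma extracted_work_max (d n : nat) (rho H : 'M[C]_d) (T : Type) (B : T -> 'M[C]_(d ^ n)) :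
  let S := [set V : 'M[C]_(d ^ n) | V \is unitarymx /\ forall t, comm_mx V (B t)] in
  exists2 V, S V & extracted_work rho H V = sup [set extracted_work rho H W | W in S].
Proof.
move=> S.
have c := @mx_of_rV_cont (d ^ n).
have cf : continuous (fun w => extracted_work rho H (@mx_of_rV (d ^ n) w)).
  rewrite /extracted_work.
  rewrite (_ : (fun w => _) = fun w => complex.Re (\tr (ntensmx rho n *m total_hamiltonian n H)
    + -1 * \tr (mx_of_rV w *m ntensmx rho n *m (mx_of_rV w) ^t* *m total_hamiltonian n H))).
    apply: (proj1 (ccontD (ccont_cst _ _) (ccontM (ccont_cst _ _) (mcont_tr _)))).
    apply: mcontM; last exact: mcont_cst.
    apply: mcontM; last exact: mcont_adj.
    by apply: mcontM => //; exact: mcont_cst.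
  by apply/funext => w; rewrite mulN1r.
have [w] : exists2 w, w \in [set w | S (@mx_of_rV (d ^ n) w)] &
   forall v, v \in [set w | S (@mx_of_rV (d ^ n) w)] ->
    extracted_work rho H (mx_of_rV v) <= extracted_work rho H (mx_of_rV w).
  apply: compact_EVT_max.
  - have [w e] := mx_of_rV_surj (1%:M : 'M[C]_(d ^ n)).
    exists w; rewrite /= e; split; first by apply/unitarymxP; rewrite trmx1 map_mx1 mulmx1.
    by move=> t; exact: comm1mx.
  - exact: compact_unitary_commutant.
  - exact: continuous_subspaceT.
rewrite inE /= => Sw max; exists (mx_of_rV w) => //.
apply/eqP; rewrite eq_le; apply/andP; split.
  apply: ub_le_sup; last by exists (mx_of_rV w).
  exists (extracted_work rho H (mx_of_rV w)) => _ [V SV <-].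
  by have [v vV] := mx_of_rV_surj V; rewrite -vV; apply: max; rewrite inE /= vV.
apply: ge_sup; first by exists (extracted_work rho H (mx_of_rV w)), (mx_of_rV w).
move=> _ [V SV <-].
by have [v vV] := mx_of_rV_surj V; rewrite -vV; apply: max; rewrite inE /= vV.
Qed.
End Attained.

Lemma max_work_attained (R : realType) (d n : nat) (rho H : 'M[R[i]]_d) :
  exists2 V : 'M[R[i]]_(d ^ n),
    V \is unitarymx & extracted_work rho H V = max_work n rho H.
Proof.
have [V [uV _] e] := extracted_work_max rho H (fun f : False => match f with end : 'M[R[i]]_(d ^ n)).
exists V => //; rewrite e; congr sup; apply/seteqP; split=> _ [W /= uW <-]; exists W => //=.
by case: uW.
Qed.

Lemma max_work_inv_attained (R : realType) (d : nat) (G : finGroupType)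
    (U : G -> 'M[R[i]]_d) (n : nat) (rho H : 'M[R[i]]_d) :
  exists2 V : 'M[R[i]]_(d ^ n),
    V \is unitarymx /\ (forall g, comm_mx V (ntensmx (U g) n)) &
    extracted_work rho H V = max_work_inv U n rho H.
Proof. exact: extracted_work_max. Qed.

(* Main.v *)
(* Only W <= W_inv asymptotically is at stake, and if rho is maximally mixed no
   work can be extracted at all. Otherwise fix n0 and an optimal unitary W on n0
   copies; s = W rho^(x) n0 W^* has mean energy e. By Chebyshev, for large k the
   state s^(x) k is almost supported on the low-energy spectral subspace E of
   k n0 copies (energies <= k (e + eta)), which is G-invariant. Hence
   rho^(x) (k n0) is almost supported on the preimage of E under W^(x) k, and on
   the G-invariant subspace T spanned by the translates of that preimage, of
   dimension <= |G| dim E.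
   A bounded number r + m of extra copies provides the missing room. As rho is
   not maximally mixed, rho^(x) r is almost supported on an invariant subspace P
   of arbitrarily small relative dimension; so T (x) P (x) all fits, by a plain
   dimension count, isometrically into E (x) P^perp via some L. On m copies there
   is a unit vector omega orthogonal to its translates by all non-scalar U(g).
   Then sum_g U(g) (L (x) omega) U(g)^* is, up to a factor, a partial isometry J
   commuting with G, and as its range is orthogonal to T (x) P (x) all, the
   unitary J + J^* + 1 - J^* J - J J^* commutes with G and sends rho^(x) N almost
   entirely to low energy. The extra copies cost O(1) energy. *)

Require Import Defs.
From mathcomp Require Import all_boot all_order all_algebra all_fingroup.
From mathcomp Require Import all_classical all_reals all_analysis.
From mathcomp Require Import cyclic spectral.
From mathcomp.real_closed Require Import complex mxtens.
From mathcomp Require Import ring lra zify.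

Set Implicit Arguments.
Unset Strict Implicit.
Unset Printing Implicit Defensive.

Import Order.TTheory GRing.Theory Num.Theory numFieldNormedType.Exports.
Local Open Scope ring_scope.
Local Open Scope sesquilinear_scope.

(** * Spectral calculus and positive matrices *)

Section Adjoint.
Variable C : numClosedFieldType.

Lemma adjmxM m n p (A : 'M[C]_(m, n)) (B : 'M[C]_(n, p)) :
  (A *m B)^t* = B^t* *m A^t*.
Proof. by rewrite trmx_mul map_mxM. Qed.

Lemma adjmxD m n (A B : 'M[C]_(m, n)) : (A + B)^t* = A^t* + B^t*.
Proof. by rewrite linearD map_mxD. Qed.

Lemma adjmxB m n (A B : 'M[C]_(m, n)) : (A - B)^t* = A^t* - B^t*.
Proof. by rewrite linearB map_mxB. Qed.

Lemma adjmxZ m n (a : C) (A : 'M[C]_(m, n)) : (a *: A)^t* = a^* *: A^t*.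
Proof. by rewrite linearZ map_mxZ. Qed.

Lemma adjmx1 n : (1%:M : 'M[C]_n)^t* = 1%:M.
Proof. by rewrite trmx1 map_mx1. Qed.

Lemma adjmx_sum (I : Type) (r : seq I) (P : pred I) m n (F : I -> 'M[C]_(m, n)) :
  (\sum_(i <- r | P i) F i)^t* = \sum_(i <- r | P i) (F i)^t*.
Proof. by rewrite linear_sum raddf_sum. Qed.

Lemma adjmx_tens m n p q (A : 'M[C]_(m, n)) (B : 'M[C]_(p, q)) :
  (A *t B)^t* = A^t* *t B^t*.
Proof. by rewrite trmx_tens map_mxT. Qed.

Lemma adjmx_cast m n m' n' (em : m = m') (en : n = n') (A : 'M[C]_(m, n)) :
  (castmx (em, en) A)^t* = castmx (en, em) (A^t*).
Proof. by case: m' / em; case: n' / en; rewrite !castmx_id. Qed.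

Lemma unitarymxPl n (B : 'M[C]_n) : B \is unitarymx -> B^t* *m B = 1%:M.
Proof. by rewrite -trmxC_unitary => /unitarymxP; rewrite trmxCK. Qed.

Lemma mxtrace_adj n (A : 'M[C]_n) : \tr (A^t*) = (\tr A)^*.
Proof. by rewrite /mxtrace rmorph_sum; apply: eq_bigr => i _; rewrite !mxE. Qed.

Lemma mxtrace_mul_adj_ge0 m n (A : 'M[C]_(m, n)) : 0 <= \tr (A *m A^t*).
Proof.
apply: sumr_ge0 => i _; rewrite mxE; apply: sumr_ge0 => k _.
by rewrite !mxE mul_conjC_ge0.
Qed.

Lemma mxtrace_mul_adj_eq0 m n (A : 'M[C]_(m, n)) : \tr (A *m A^t*) = 0 -> A = 0.
Proof.
move=> /eqP; rewrite psumr_eq0 => [/allP h0|i _]; last first.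
  by rewrite mxE; apply: sumr_ge0 => k _; rewrite !mxE mul_conjC_ge0.
apply/matrixP => i j; rewrite [RHS]mxE.
have := h0 i (mem_index_enum _); rewrite /= mxE psumr_eq0; last first.
  by move=> k _; rewrite !mxE mul_conjC_ge0.
move=> /allP /(_ j (mem_index_enum _)); rewrite /= !mxE mul_conjC_eq0.
by move/eqP.
Qed.

End Adjoint.

Section Tensor.
Variable R : comPzRingType.

Lemma tensmxDl m n p q (A B : 'M[R]_(m, n)) (X : 'M[R]_(p, q)) :
  (A + B) *t X = A *t X + B *t X.
Proof. by apply/matrixP => i j; rewrite !mxE mulrDl. Qed.

Lemma tensmxDr m n p q (A B : 'M[R]_(m, n)) (X : 'M[R]_(p, q)) :
  X *t (A + B) = X *t A + X *t B.
Proof. by apply/matrixP => i j; rewrite !mxE mulrDr. Qed.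

Lemma tensmxBl m n p q (A B : 'M[R]_(m, n)) (X : 'M[R]_(p, q)) :
  (A - B) *t X = A *t X - B *t X.
Proof. by apply/matrixP => i j; rewrite !mxE mulrBl. Qed.

Lemma tensmxBr m n p q (A B : 'M[R]_(m, n)) (X : 'M[R]_(p, q)) :
  X *t (A - B) = X *t A - X *t B.
Proof. by apply/matrixP => i j; rewrite !mxE mulrBr. Qed.

Lemma tensmxZl m n p q a (A : 'M[R]_(m, n)) (X : 'M[R]_(p, q)) :
  (a *: A) *t X = a *: (A *t X).
Proof. by apply/matrixP => i j; rewrite !mxE mulrA. Qed.

Lemma tensmxZr m n p q a (A : 'M[R]_(m, n)) (X : 'M[R]_(p, q)) :
  X *t (a *: A) = a *: (X *t A).
Proof. by apply/matrixP => i j; rewrite !mxE mulrCA. Qed.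

Lemma tensmx11 m n : (1%:M : 'M[R]_m) *t (1%:M : 'M[R]_n) = 1%:M.
Proof.
apply/matrixP => i j; case: (mxtens_indexP i) => i0 i1.
case: (mxtens_indexP j) => j0 j1; rewrite tensmxE !mxE -natrM mulnb.
rewrite (inj_eq (can_inj (@mxtens_indexK m n))) xpair_eqE.
by [].
Qed.

Lemma mxtrace_tens m n (A : 'M[R]_m) (B : 'M[R]_n) : \tr (A *t B) = \tr A * \tr B.
Proof.
by rewrite /mxtrace mulr_sum; apply: eq_bigr => i _; rewrite mxE.
Qed.

End Tensor.

Section Spectral.
Variable C : numClosedFieldType.

Definition diagR n (f : 'I_n -> C) : 'M[C]_n := diag_mx (\row_i f i).

Lemma eq_diagR n (f g : 'I_n -> C) : f =1 g -> diagR f = diagR g.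
Proof. by move=> e; congr diag_mx; apply/rowP => i; rewrite !mxE e. Qed.

Lemma diagR_adj n (f : 'I_n -> C) :
  (forall i, f i \is Num.real) -> (diagR f)^t* = diagR f.
Proof.
move=> fR; rewrite /diagR tr_diag_mx map_diag_mx; congr diag_mx.
by apply/rowP => i; rewrite !mxE; exact: conj_Creal.
Qed.

Lemma diagRM n (f g : 'I_n -> C) : diagR f *m diagR g = diagR (fun i => f i * g i).
Proof. by rewrite /diagR mulmx_diag; congr diag_mx; apply/rowP => i; rewrite !mxE. Qed.

Lemma diagRD n (f g : 'I_n -> C) : diagR f + diagR g = diagR (fun i => f i + g i).
Proof. by rewrite /diagR -linearD /=; congr diag_mx; apply/rowP => i; rewrite !mxE. Qed.

Lemma diagRZ n a (f : 'I_n -> C) : a *: diagR f = diagR (fun i => a * f i).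
Proof. by rewrite /diagR -linearZ /=; congr diag_mx; apply/rowP => i; rewrite !mxE. Qed.

Lemma diagR1 n : diagR (fun _ : 'I_n => 1) = 1%:M.
Proof.
by rewrite /diagR -diag_const_mx; congr diag_mx; apply/rowP => i; rewrite !mxE.
Qed.

(** With the eigenbasis B fixed, square roots, spectral projections and pseudo-inverses become
    pointwise arithmetic on the eigenvalue function f. *)
Definition specmx n (B : 'M[C]_n) (f : 'I_n -> C) : 'M[C]_n :=
  B^t* *m diagR f *m B.

Lemma eq_specmx n (B : 'M[C]_n) f g : f =1 g -> specmx B f = specmx B g.
Proof. by move=> e; rewrite /specmx (eq_diagR e). Qed.

Lemma specmx_adj n (B : 'M[C]_n) f :
  (forall i, f i \is Num.real) -> (specmx B f)^t* = specmx B f.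
Proof. by move=> fR; rewrite /specmx !adjmxM trmxCK diagR_adj // mulmxA. Qed.

Section Unitary.
Variables (n : nat) (B : 'M[C]_n).
Hypothesis uB : B \is unitarymx.

Lemma specmxM f g : specmx B f *m specmx B g = specmx B (fun i => f i * g i).
Proof.
by rewrite /specmx !mulmxA (mulmxtVK _ uB) -(mulmxA _ (diagR f) (diagR g)) diagRM.
Qed.

Lemma specmx1 : specmx B (fun=> 1) = 1%:M.
Proof. by rewrite /specmx diagR1 mulmx1 unitarymxPl. Qed.

Lemma specmxD f g : specmx B f + specmx B g = specmx B (fun i => f i + g i).
Proof. by rewrite /specmx -mulmxDl -mulmxDr diagRD. Qed.

Lemma specmxZ a f : a *: specmx B f = specmx B (fun i => a * f i).
Proof. by rewrite /specmx scalemxAl scalemxAr diagRZ. Qed.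

Lemma specmxB f g : specmx B f - specmx B g = specmx B (fun i => f i - g i).
Proof.
by rewrite -scaleN1r specmxZ specmxD; apply: eq_specmx => i; rewrite mulN1r.
Qed.

Lemma scalar_specmx z : z%:M = specmx B (fun=> z).
Proof.
rewrite -scalemx1 -specmx1 specmxZ; apply: eq_specmx => i.
by rewrite mulr1.
Qed.

Lemma mxtrace_specmx f : \tr (specmx B f) = \sum_i f i.
Proof.
rewrite /specmx mxtrace_mulC mulmxA (unitarymxP uB) mul1mx mxtrace_diag.
by apply: eq_bigr => i _; rewrite mxE.
Qed.

(** In the eigenbasis, commuting with a diagonal matrix means that entry (i, j) vanishes unless f i
    = f j, and then also g (f i) = g (f j). *)
Lemma comm_specmx (X : 'M[C]_n) f (g : C -> C) :
  comm_mx X (specmx B f) -> comm_mx X (specmx B (fun i => g (f i))).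
Proof.
have [Y XE] : exists Y, X = B^t* *m Y *m B.
  by exists (B *m X *m B^t*); rewrite !mulmxA unitarymxPl // mul1mx mulmxKtV.
have key h : comm_mx X (specmx B h) <->
    comm_mx Y (diagR h).
  rewrite /comm_mx /specmx XE; set D := diagR h.
  rewrite !mulmxA !(mulmxtVK _ uB); split; last first.
    by move=> e; rewrite -(mulmxA _ Y D) e mulmxA.
  move=> /(congr1 (fun Z => B *m Z *m B^t*)).
  by rewrite !mulmxA (unitarymxP uB) !mul1mx !(mulmxtVK _ uB).
move=> /key cf; apply/key.
apply/matrixP => i j; move/matrixP/(_ i j): cf.
rewrite /diagR !mul_mx_diag !mul_diag_mx !mxE => /eqP.
rewrite mulrC -subr_eq0 -mulrBl mulf_eq0 subr_eq0 => /orP[/eqP[->]|/eqP->].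
  by rewrite mulrC.
by rewrite mul0r mulr0.
Qed.

End Unitary.

Lemma hermitian_spectral n (A : 'M[C]_n) : A^t* = A ->
  exists2 B : 'M[C]_n, B \is unitarymx &
    exists2 f, (forall i, f i \is Num.real) & A = specmx B f.
Proof.
move=> hA; have hH : A \is hermsymmx.
  by apply/is_hermitianmxP; rewrite expr0 scale1r hA.
exists (spectralmx A); first exact: spectral_unitarymx.
exists (fun i => spectral_diag A 0 i).
  by move=> i; have /mxOverP := hermitian_spectral_diag_real hH; apply.
have /orthomx_spectralP {1}-> := hermitian_normalmx hH.
rewrite /specmx (invmx_unitary (spectral_unitarymx A)).
congr mulmx; congr mulmx; rewrite /diagR; congr diag_mx; apply/rowP => i.
by rewrite mxE.
Qed.

Definition psd n (A : 'M[C]_n) : Prop :=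
  A^t* = A /\ forall u : 'rV[C]_n, 0 <= (u *m A *m u ^t*) 0 0.

Lemma psdD n (A B : 'M[C]_n) : psd A -> psd B -> psd (A + B).
Proof.
move=> [hA pA] [hB pB]; split; first by rewrite adjmxD hA hB.
by move=> u; rewrite mulmxDr mulmxDl mxE addr_ge0.
Qed.

Lemma psd_mul_adj m n (S : 'M[C]_(m, n)) : psd (S *m S^t*).
Proof.
split=> [|u]; first by rewrite adjmxM trmxCK.
rewrite mulmxA -mulmxA -adjmxM mxE.
by apply: sumr_ge0 => k _; rewrite !mxE mul_conjC_ge0.
Qed.

Lemma psd_specmx n (B : 'M[C]_n) f : (forall i, 0 <= f i) -> psd (specmx B f).
Proof.
move=> f0; split; first by apply: specmx_adj => i; exact: ger0_real.
move=> u; rewrite /specmx.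
set v := u *m B^t*.
have -> : u *m (B^t* *m diagR f *m B) *m u^t* = v *m diagR f *m v^t*.
  by rewrite /v adjmxM trmxCK !mulmxA.
rewrite mxE; apply: sumr_ge0 => k _.
rewrite /diagR mul_mx_diag !mxE mulrAC mulr_ge0 ?mul_conjC_ge0 //.
Qed.

Lemma psd_specmx_ge0 n (B : 'M[C]_n) f i : B \is unitarymx ->
  psd (specmx B f) -> 0 <= f i.
Proof.
move=> uB [_ pA]; have := pA (delta_mx 0 i *m B).
rewrite /specmx adjmxM !mulmxA !(mulmxtVK _ uB).
rewrite -!mulmxA [diag_mx _ *m _]mul_diag_mx.
rewrite mxE (bigD1 i) //= big1 => [|j ji]; rewrite !mxE eqxx ?(negbTE ji) ?mul0r //=.
by rewrite eqxx mul1r conjC1 mulr1 addr0.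
Qed.

Lemma psd_spectral n (A : 'M[C]_n) : psd A ->
  exists2 B : 'M[C]_n, B \is unitarymx &
    exists2 f, (forall i, 0 <= f i) & A = specmx B f.
Proof.
move=> pA; have [B uB [f fR fA]] := hermitian_spectral (proj1 pA).
exists B => //; exists f => // i.
by apply: (psd_specmx_ge0 i uB); rewrite -fA.
Qed.

(** Take square roots of the eigenvalues. Positivity becomes an identity, from which closure under
    conjugation and tensor products follows algebraically. *)
Lemma psd_factor n (A : 'M[C]_n) : psd A -> exists S : 'M[C]_n, A = S *m S^t*.
Proof.
move=> /psd_spectral[B uB [f f0 ->]]; exists (specmx B (fun i => sqrtC (f i))).
rewrite specmx_adj => [|i]; last by rewrite ger0_real // sqrtC_ge0.
by rewrite specmxM //; apply: eq_specmx => i; rewrite -expr2 sqrtCK.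
Qed.

Lemma psd_conj m n (A : 'M[C]_n) (V : 'M[C]_(m, n)) : psd A -> psd (V *m A *m V^t*).
Proof.
move=> /psd_factor[S ->]; rewrite mulmxA -mulmxA -adjmxM; exact: psd_mul_adj.
Qed.

Lemma psd_tens m n (A : 'M[C]_m) (B : 'M[C]_n) : psd A -> psd B -> psd (A *t B).
Proof.
move=> /psd_factor[S ->] /psd_factor[T ->].
by rewrite -tensmx_mul -adjmx_tens; exact: psd_mul_adj.
Qed.

Lemma mxtrace_psd_ge0 n (A B : 'M[C]_n) : psd A -> psd B -> 0 <= \tr (A *m B).
Proof.
move=> /psd_factor[S ->] /psd_factor[T ->].
rewrite !mulmxA mxtrace_mulC !mulmxA -mulmxA.
by rewrite -{2}[T]trmxCK -adjmxM mxtrace_mul_adj_ge0.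
Qed.

Definition projector n (P : 'M[C]_n) : Prop := P^t* = P /\ P *m P = P.

Lemma projector_psd n (P : 'M[C]_n) : projector P -> psd P.
Proof. by move=> [hP PP]; rewrite -PP -{2}hP; exact: psd_mul_adj. Qed.

Lemma projectorC n (P : 'M[C]_n) : projector P -> projector (1%:M - P).
Proof.
move=> [hP PP]; split; first by rewrite adjmxB adjmx1 hP.
by rewrite mulmxBl mul1mx mulmxBr mulmx1 PP subrr subr0.
Qed.

Lemma projector_tens m n (P : 'M[C]_m) (Q : 'M[C]_n) :
  projector P -> projector Q -> projector (P *t Q).
Proof. by move=> [hP PP] [hQ QQ]; split; rewrite ?adjmx_tens ?tensmx_mul ?hP ?hQ ?PP ?QQ. Qed.

Lemma projector1 n : projector (1%:M : 'M[C]_n).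
Proof. by split; rewrite ?adjmx1 ?mul1mx. Qed.

Lemma projector_specmx n (B : 'M[C]_n) (p : pred 'I_n) : B \is unitarymx ->
  projector (specmx B (fun i => (p i)%:R)).
Proof.
move=> uB; split; first by apply: specmx_adj => i; exact: realn.
by rewrite specmxM //; apply: eq_specmx => i; rewrite -natrM mulnb andbb.
Qed.

(** The range of P lies inside that of Q, so Q - P is a projector, hence positive. *)
Lemma mxtrace_projector_le n (A P Q : 'M[C]_n) : psd A -> projector P -> projector Q ->
  Q *m P = P -> \tr (A *m P) <= \tr (A *m Q).
Proof.
move=> pA [hP PP] [hQ QQ] QP; have PQ : P *m Q = P by rewrite -hP -{1}hQ -adjmxM QP.
rewrite -subr_ge0 -raddfB /= -mulmxBr; apply: mxtrace_psd_ge0 => //; apply: projector_psd.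
split; first by rewrite adjmxB hP hQ.
by rewrite mulmxBl !mulmxBr QQ PQ QP PP subrr subr0.
Qed.

Lemma projector_factor n (P : 'M[C]_n) : projector P ->
  exists p (B : 'M[C]_(p, n)), B *m B^t* = 1%:M /\ B^t* *m B = P.
Proof.
move=> [hP PP]; have [B uB [f _ fP]] := hermitian_spectral hP.
(* Idempotence forces every eigenvalue to be 0 or 1; the rows of B with eigenvalue 1 form the
   factor. *)
have f01 i : f i = (f i != 0)%:R.
  move: PP; rewrite fP (specmxM uB) => /(congr1 (fun X => (B *m X *m B^t*) i i)).
  rewrite /specmx !mulmxA (unitarymxP uB) !mul1mx !(mulmxtVK _ uB) /diagR !mxE eqxx.
  rewrite !mulr1n => /eqP; rewrite -subr_eq0 -{3}[f i]mulr1 -mulrBr mulf_eq0 subr_eq0.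
  by have [->|_ /= /eqP ->] := eqVneq (f i) 0.
pose S := [pred i | f i != 0].
exists #|S|, (\matrix_(k < #|S|) row (enum_val k) B); split.
  apply/matrixP => k l.
  have /unitarymxP/matrixP/(_ (enum_val k) (enum_val l)) := uB.
  rewrite !mxE (inj_eq enum_val_inj) => <-.
  by apply: eq_bigr => j _; rewrite !mxE.
rewrite fP; apply/matrixP => i j; rewrite mxE.
have -> : specmx B f i j = \sum_(k in S) (B k i)^* * B k j.
  rewrite /specmx /diagR mul_mx_diag mxE [RHS]big_mkcond; apply: eq_bigr => k _.
  rewrite !mxE f01 inE.
  by case: (f k != 0); rewrite ?mulr1 ?mulr0 ?mul0r.
by rewrite [RHS]big_enum_val; apply: eq_bigr => k _; rewrite !mxE.
Qed.

Lemma mxtrace_projector n (P : 'M[C]_n) : projector P -> \tr P = (\rank P)%:R.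
Proof.
move=> /projector_factor[p [B [BB <-]]]; rewrite mxtrace_mulC BB mxtrace1; congr _%:R.
apply/eqP; rewrite eqn_leq; apply/andP; split.
  rewrite -{1}(mxrank1 C p) -[1%:M]mulmx1 -{1}BB -BB mulmxA -(mulmxA B).
  exact: leq_trans (mxrankM_maxl _ _) (mxrankM_maxr _ _).
exact: leq_trans (mxrankM_maxr _ _) (rank_leq_row _).
Qed.

(** Traces of projectors are dimensions, so an orthonormal basis of the range of P can be sent,
    through [pid_mx], to part of one of the range of Q. *)
Lemma partial_isometry_of_mxtrace m n (P : 'M[C]_n) (Q : 'M[C]_m) :
  projector P -> projector Q -> \tr P <= \tr Q ->
  exists L : 'M[C]_(m, n), L^t* *m L = P /\ Q *m L = L.
Proof.
move=> /projector_factor[p [B [BB <-]]] /projector_factor[q [D [DD <-]]].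
rewrite mxtrace_mulC BB mxtrace1 mxtrace_mulC DD mxtrace1 ler_nat => pq.
exists (D^t* *m (pid_mx p : 'M[C]_(q, p)) *m B); split.
  rewrite !adjmxM trmxCK !mulmxA -(mulmxA _ D) DD mulmx1 tr_pid_mx map_pid_mx.
  by rewrite -[_ *m pid_mx p *m pid_mx p]mulmxA mul_pid_mx minnn (minn_idPr pq) pid_mx_1 mulmx1.
by rewrite !mulmxA -(mulmxA _ D) DD mulmx1.
Qed.

(* The twirl of P0 has the right kernel, and its support projector, being a
   function of it, commutes with everything it commutes with. *)
Lemma support_projector n (I : finType) (U : I -> 'M[C]_n) (P0 : 'M[C]_n) i0 :
  (forall i, U i \is unitarymx) -> projector P0 ->
  U i0 *m P0 *m (U i0)^t* = P0 ->
  exists P, [/\ projector P, P *m P0 = P0, \tr P <= #|I|%:R * \tr P0 &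
    forall X, comm_mx X (\sum_i U i *m P0 *m (U i)^t*) -> comm_mx X P].
Proof.
move=> uU pP0 U1; have [hP0 PP0] := pP0.
set A := \sum_i _.
have hA : A^t* = A.
  rewrite adjmx_sum; apply: eq_bigr => i _.
  by rewrite !adjmxM trmxCK hP0 mulmxA.
have [B uB [f _ fA]] := hermitian_spectral hA.
have pP : projector (specmx B (fun i => (f i != 0)%:R)).
  exact: (projector_specmx (fun i => f i != 0) uB).
set P := specmx B _ in pP *; exists P; split => //.
- have [hP PP] := pP.
  have AP : A *m (1%:M - P) = 0.
    rewrite mulmxBr mulmx1 fA (specmxM uB) [X in _ - X](_ : _ = specmx B f) ?subrr //.
    by apply: eq_specmx => i; have [->|] := eqVneq (f i) 0; rewrite ?mul0r ?mulr1.
  (* A is a sum of positive terms, so each of them vanishes when compressed by 1 - P; the term at i0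
     is P0 itself. *)
  have : \tr ((1%:M - P) *m A *m (1%:M - P)^t*) = 0.
    by rewrite (proj1 (projectorC pP)) -mulmxA AP mulmx0 mxtrace0.
  rewrite /A mulmx_sumr mulmx_suml raddf_sum => /eqP.
  have E i : (1%:M - P) *m (U i *m P0 *m (U i)^t*) *m (1%:M - P)^t* =
     ((1%:M - P) *m U i *m P0) *m ((1%:M - P) *m U i *m P0)^t*.
    by rewrite !adjmxM hP0 !mulmxA -[_ *m P0 *m P0]mulmxA PP0.
  rewrite psumr_eq0 => [/allP/(_ i0 (mem_index_enum _))/= /eqP|i _]; last first.
    by rewrite E; exact: mxtrace_mul_adj_ge0.
  rewrite U1 -PP0 -{2}hP0 mulmxA -mulmxA -adjmxM => /mxtrace_mul_adj_eq0.
  rewrite mulmxBl mul1mx => /eqP.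
  by rewrite subr_eq0 PP0 => /eqP.
(* Since 0 inverts to 0, the second factor is the pseudo-inverse of A. Hence rank P is at most rank
   A, and A is a sum of #|I| matrices of rank at most rank P0. *)
- have -> : P = A *m specmx B (fun i => (f i)^-1).
    rewrite fA (specmxM uB); apply: eq_specmx => i.
    by have [->|/mulfV->] := eqVneq (f i) 0; rewrite ?mul0r.
  rewrite mxtrace_projector; last first.
    rewrite fA (specmxM uB) (@eq_specmx _ _ _ (fun i => (f i != 0)%:R)) // => i.
    by have [->|/mulfV->] := eqVneq (f i) 0; rewrite ?mul0r.
  rewrite mxtrace_projector // -natrM ler_nat.
  apply: leq_trans (mxrankM_maxl _ _) _.
  rewrite /A -sum_nat_const; elim/big_ind2: _ => [|X a Y b hX hY|i _].
  - by rewrite mxrank0.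
  - exact: leq_trans (mxrank_add _ _) (leq_add hX hY).
  - exact: leq_trans (mxrankM_maxl _ _) (mxrankM_maxr _ _).
- move=> X cX; apply: (comm_specmx uB (fun x => (x != 0)%:R)).
  by rewrite -fA.
Qed.

End Spectral.

(** * Invariant unitaries *)

Section ProjectiveRep.
Variables (C : numClosedFieldType) (G : finGroupType).

(** Asking only for some phase at each pair, and not for a named cocycle, makes tensor products
    immediate. *)
Definition proj_rep n (U : G -> 'M[C]_n) : Prop :=
  (forall g, U g \is unitarymx) /\
  forall g h, exists2 w : C, `|w| = 1 & U g *m U h = w *: U (g * h)%g.

Lemma proj_rep_tens m n (U : G -> 'M[C]_m) (V : G -> 'M[C]_n) :
  proj_rep U -> proj_rep V -> proj_rep (fun g => U g *t V g).
Proof.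
move=> [uU mU] [uV mV]; split=> [g|g h].
  apply/unitarymxP; rewrite adjmx_tens tensmx_mul (unitarymxP (uU g)).
  by rewrite (unitarymxP (uV g)) tensmx11.
have [w w1 e] := mU g h; have [z z1 e'] := mV g h.
exists (w * z); first by rewrite normrM w1 z1 mulr1.
by rewrite tensmx_mul e e' tensmxZl tensmxZr scalerA.
Qed.

Section Conjugation.
Variables (n : nat) (U : G -> 'M[C]_n).
Hypothesis repU : proj_rep U.

Definition conjrep g (X : 'M[C]_n) := U g *m X *m (U g)^t*.

Lemma conjrepM g X Y : conjrep g X *m conjrep g Y = conjrep g (X *m Y).
Proof.
have uU := proj1 repU g.
by rewrite /conjrep !mulmxA -(mulmxA _ _ (U g)) unitarymxPl // mulmx1.
Qed.

Lemma conjrep_adj g X : (conjrep g X)^t* = conjrep g (X^t*).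
Proof. by rewrite /conjrep !adjmxM trmxCK mulmxA. Qed.

(** The phase cancels against its conjugate: conjugation is a genuine action although U is only
    projective. *)
Lemma conjrep_comp g h X : conjrep g (conjrep h X) = conjrep (g * h)%g X.
Proof.
have [w w1 e] := proj2 repU g h.
rewrite /conjrep !mulmxA e -mulmxA -adjmxM e adjmxZ -scalemxAr -!scalemxAl scalerA.
by rewrite mulrC -normCK w1 expr1n scale1r.
Qed.

Lemma conjrep_id g X : comm_mx X (U g) -> conjrep g X = X.
Proof. by move=> c; rewrite /conjrep -c -mulmxA (unitarymxP (proj1 repU g)) mulmx1. Qed.

Lemma conjrep_scalar g z X : U g = z%:M -> conjrep g X = X.
Proof. by move=> e; apply: conjrep_id; rewrite e; exact: comm_mx_scalar. Qed.

Lemma comm_conjrep g X : conjrep g X = X -> comm_mx X (U g).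
Proof.
move=> e; rewrite /comm_mx -{1}e /conjrep -mulmxA.
by rewrite unitarymxPl ?mulmx1 //; exact: (proj1 repU).
Qed.

Lemma proj_rep1 : exists z, U 1%g = z%:M.
Proof.
have [w w1] := proj2 repU 1%g 1%g; rewrite mulg1 => e; exists w.
have := congr1 (fun X => X *m (U 1%g)^t*) e.
by rewrite -mulmxA -scalemxAl (unitarymxP (proj1 repU 1%g)) mulmx1 scalemx1.
Qed.

Lemma conjrep_sum_invariant X h : comm_mx (\sum_g conjrep g X) (U h).
Proof.
apply: comm_conjrep; rewrite {1}/conjrep mulmx_sumr mulmx_suml.
rewrite [RHS](reindex_inj (mulgI h)); apply: eq_bigr => g _.
exact: conjrep_comp.
Qed.

Lemma comm_adj X h : comm_mx X (U h) -> comm_mx (X^t*) (U h).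
Proof.
by move=> c; apply: comm_conjrep; rewrite -conjrep_adj conjrep_id.
Qed.

(** Apply [support_projector] to the twirl over G. U 1 is a scalar, so P0 is itself one of the
    translates. *)
Lemma invariant_support (P0 : 'M[C]_n) : projector P0 ->
  exists P, [/\ projector P, P *m P0 = P0, \tr P <= #|G|%:R * \tr P0 &
    forall h, comm_mx P (U h)].
Proof.
move=> pP0; have [z z1] := proj_rep1.
have [] := @support_projector _ _ _ U _ 1%g (proj1 repU) pP0.
  exact: (conjrep_scalar _ z1).
move=> P [pP PP0 trP cP]; exists P; split=> // h.
by apply/comm_mx_sym/cP/comm_mx_sym; exact: conjrep_sum_invariant.
Qed.

End Conjugation.

(* The unitary exchanges the ranges of P = J^* J and J J^*, which are
   orthogonal, and fixes the complement of their sum. *)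
Lemma swap_unitary n (J P Q : 'M[C]_n) : projector P -> projector Q ->
  J^t* *m J = P -> Q *m J = J -> Q *m P = 0 ->
  exists V, [/\ V \is unitarymx, V *m P = J &
    forall X, comm_mx J X -> comm_mx (J^t*) X -> comm_mx V X].
Proof.
move=> pP [hQ QQ] KJ QJ QP; have [hP PP] := pP.
have PQ : P *m Q = 0 by rewrite -hP -hQ -adjmxM QP trmx0 map_mx0.
have PJ : P *m J = 0 by rewrite -QJ mulmxA PQ mul0mx.
(* With X = J (1 - P) one has X^* X = (1 - P) P (1 - P) = 0, hence X = 0. *)
have JP : J *m P = J.
  apply/esym/eqP; rewrite -subr_eq0 -{1}[J]mulmx1 -mulmxBr; apply/eqP.
  rewrite -[LHS]trmxCK -[RHS](trmxCK (0 : 'M[C]_n)) trmx0 map_mx0; congr (_ ^t*).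
  apply: mxtrace_mul_adj_eq0; rewrite trmxCK adjmxM (proj1 (projectorC pP)).
  by rewrite mulmxA -(mulmxA _ (J^t*)) KJ mulmxBl mul1mx PP subrr mul0mx mxtrace0.
set K := J^t* in KJ *.
have JJ : J *m J = 0 by rewrite -{1}JP -mulmxA PJ mulmx0.
have KK : K *m K = 0 by rewrite -adjmxM JJ trmx0 map_mx0.
have KP : K *m P = 0 by rewrite -hP -adjmxM PJ trmx0 map_mx0.
have PK : P *m K = K by rewrite -{1}hP -adjmxM JP.
set N := J *m K.
have NJ : N *m J = J by rewrite -mulmxA KJ JP.
have NK : N *m K = 0 by rewrite -mulmxA KK mulmx0.
have NP : N *m P = 0 by rewrite -mulmxA KP mulmx0.
have hN : N^t* = N by rewrite /N /K adjmxM trmxCK.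
pose V := J + K + 1%:M - P - N.
have hV : V^t* = V by rewrite !(adjmxB, adjmxD) adjmx1 hP hN trmxCK (addrC K).
have VP : V *m P = J.
  by rewrite !mulmxBl !mulmxDl mul1mx JP KP PP NP addr0 addrK subr0.
have VJ : V *m J = P.
  by rewrite !mulmxBl !mulmxDl mul1mx JJ KJ PJ NJ add0r subr0 addrK.
have VK : V *m K = N.
  by rewrite !mulmxBl !mulmxDl mul1mx KK PK NK addr0 subr0 addrK.
have VN : V *m N = K by rewrite mulmxA VJ.
exists V; split=> //.
  (* V is Hermitian, so unitarity is V V = 1, read off from the products of V with J, K, P and N. *)
  apply/unitarymxP; rewrite hV {2}/V !(mulmxBr, mulmxDr) mulmx1 VJ VK VP VN /V.
  by apply/matrixP => i j; rewrite !mxE; ring.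
move=> X /comm_mx_sym cJ /comm_mx_sym cK; apply/comm_mx_sym.
have cKJ : comm_mx X P by rewrite -KJ; exact: comm_mxM.
apply: comm_mxB; last exact: comm_mxM.
apply: comm_mxB => //; apply: comm_mxD; last exact: comm_mx1.
exact: comm_mxD.
Qed.

Section Swap.
Variables (a b : nat) (A : G -> 'M[C]_a) (B : G -> 'M[C]_b).
Hypotheses (repA : proj_rep A) (repB : proj_rep B).
Let W g : 'M[C]_(a * b) := A g *t B g.

(* omega plays the role of a reference frame: its orbit is orthonormal up to
   the elements of G which act as scalars, so that
   J = sum_g W_g (1 (x) omega) L W_g^* is, up to a factor, isometric wherever
   L is, and commutes with the representation. *)
Lemma invariant_swap (omega : 'cV[C]_b) (P : 'M[C]_(a * b)) (E : 'M[C]_a) :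
  omega^t* *m omega = 1%:M ->
  (forall g, (exists z, W g = z%:M) \/ omega^t* *m B g *m omega = 0) ->
  projector P -> (forall g, comm_mx P (W g)) ->
  projector E -> (forall g, comm_mx E (A g)) ->
  (E *t 1%:M) *m P = 0 -> \tr P <= \tr E ->
  exists V, [/\ V \is unitarymx, forall g, comm_mx V (W g) &
    (E *t 1%:M) *m V *m P = V *m P].
Proof.
move=> oo oB pP cP pE cE EP trPE.
have repW : proj_rep W by exact: proj_rep_tens.
(* Writing the height of L as [a * 1] lets the column omega be tensored on afterwards. *)
have [L [LL EL]] : exists L : 'M[C]_(a * 1, a * b),
    L^t* *m L = P /\ (E *t 1%:M) *m L = L.
  apply: partial_isometry_of_mxtrace => //.
    by apply: projector_tens => //; exact: projector1.
  by rewrite mxtrace_tens mxtrace1 mulr1.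
pose I0 : 'M[C]_(a * b, a * 1) := 1%:M *t omega.
pose M := I0 *m L.
have I0E X Y : I0^t* *m (X *t Y) *m I0 = X *t (omega^t* *m Y *m omega).
  by rewrite adjmx_tens !tensmx_mul adjmx1 mul1mx mulmx1.
have MM : M^t* *m M = P.
  rewrite adjmxM mulmxA -(mulmxA _ _ I0).
  have := I0E 1%:M 1%:M; rewrite !tensmx11 mulmx1 => ->.
  by rewrite mulmx1 oo tensmx11 mulmx1 LL.
(* Membership is decided by the overlap itself. All g acting as scalars belong to S, and outside S
   the overlap is 0. *)
pose S := [pred g | M^t* *m conjrep W g M == P].
have MS g : M^t* *m conjrep W g M = if g \in S then P else 0.
  rewrite inE; case: eqP => // nP; case: (oB g) => [[z Wz]|o0].
    by case: nP; rewrite (conjrep_scalar repW _ Wz) MM.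
  rewrite /conjrep /M adjmxM !mulmxA -(mulmxA _ (I0^t*) (W g)).
  by rewrite -(mulmxA _ _ I0) I0E o0 tensmx0 mulmx0 !mul0mx.
have S1 : 1%g \in S.
  by have [z z1] := proj_rep1 repW; rewrite inE (conjrep_scalar repW _ z1) MM.
have MgMh g h : (conjrep W g M)^t* *m conjrep W h M =
    if (g^-1 * h)%g \in S then P else 0.
  rewrite conjrep_adj // -[h in LHS](mulKVg g) -(conjrep_comp repW).
  rewrite conjrepM // MS; case: ifP => _; first by rewrite conjrep_id.
  by rewrite /conjrep mulmx0 mul0mx.
pose J0 := \sum_g conjrep W g M.
(* For each g, exactly #|S| translates h overlap with it, those with g^-1 h in S. This count fixes
   the normalisation c. *)
have JJ0 : J0^t* *m J0 = (#|G|%:R * #|S|%:R) *: P.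
  rewrite adjmx_sum mulmx_suml.
  have -> : (#|G|%:R * #|S|%:R) *: P = \sum_(g : G) (#|S|%:R *: P).
    by rewrite sumr_const -[RHS]scaler_nat scalerA.
  apply: eq_bigr => g _; rewrite mulmx_sumr (reindex_inj (mulgI g)) /=.
  rewrite (eq_bigr (fun h => if h \in S then P else 0)) => [|h _].
    by rewrite -big_mkcond sumr_const scaler_nat.
  by rewrite MgMh mulKg.
have c0 : 0 < (#|G|%:R * #|S|%:R : C).
  rewrite mulr_gt0 // ltr0n; first by apply/card_gt0P; exists 1%g.
  by apply/card_gt0P; exists 1%g.
pose c : C := (sqrtC (#|G|%:R * #|S|%:R))^-1.
pose J := c *: J0.
have JJ : J^t* *m J = P.
  rewrite adjmxZ -scalemxAl -scalemxAr JJ0 !scalerA conj_Creal; last first.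
    by rewrite ger0_real // invr_ge0 sqrtC_ge0 ltW.
  by rewrite -expr2 exprVn sqrtCK mulVf ?scale1r // gt_eqF.
have cE1 g : comm_mx (E *t 1%:M) (W g).
  by rewrite /comm_mx !tensmx_mul mul1mx mulmx1 cE.
have EJ : (E *t 1%:M) *m J = J.
  rewrite -scalemxAr mulmx_sumr; congr (_ *: _); apply: eq_bigr => g _.
  rewrite /conjrep !mulmxA cE1 -!mulmxA; congr (_ *m _); rewrite !mulmxA; congr (_ *m _).
  rewrite tensmx_mul mul1mx mulmx1 -[in RHS]EL mulmxA tensmx_mul mul1mx mulmx1.
  by [].
have cJ g : comm_mx J (W g).
  have := conjrep_sum_invariant repW M g.
  by rewrite /comm_mx -scalemxAl -scalemxAr => ->.
have [] := swap_unitary pP (projector_tens pE (projector1 _ _)) JJ EJ EP.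
move=> V [uV VP cV]; exists V; split=> //; last by rewrite -mulmxA VP EJ.
by move=> g; apply: cV => //; exact: comm_adj.
Qed.

End Swap.
End ProjectiveRep.

(** * Tensor powers *)

Section TensorPowers.
Variable R : comPzRingType.

(** Equality across dimensions such as d^k * d^l and d^(k + l) that are only provably equal; as a
    relation it composes without tracking casts. *)
Definition same_mx m n m' n' (X : 'M[R]_(m, n)) (Y : 'M[R]_(m', n')) : Prop :=
  exists em en, castmx (em, en) X = Y.

Lemma same_mx_refl m n (X : 'M[R]_(m, n)) : same_mx X X.
Proof. by exists erefl, erefl; rewrite castmx_id. Qed.

Lemma same_mx_sym m n m' n' (X : 'M[R]_(m, n)) (Y : 'M[R]_(m', n')) :
  same_mx X Y -> same_mx Y X.
Proof. by move=> [em [en <-]]; exists (esym em), (esym en); rewrite castmxK. Qed.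

Lemma same_mx_trans m n m' n' m'' n'' (X : 'M[R]_(m, n)) (Y : 'M[R]_(m', n'))
    (Z : 'M[R]_(m'', n'')) : same_mx X Y -> same_mx Y Z -> same_mx X Z.
Proof.
move=> [em [en <-]] [em' [en' <-]].
by exists (etrans em em'), (etrans en en'); rewrite castmx_comp.
Qed.

Lemma same_mx_cast m n m' n' e (X : 'M[R]_(m, n)) : same_mx X (castmx e X : 'M[R]_(m', n')).
Proof. by exists e.1, e.2; case: e. Qed.

Lemma same_mx_eq m n (X Y : 'M[R]_(m, n)) : same_mx X Y -> X = Y.
Proof.
move=> [em [en <-]]; rewrite (eq_irrelevance em erefl) (eq_irrelevance en erefl).
by rewrite castmx_id.
Qed.

Lemma same_mx_tens m n m' n' p q p' q' (X : 'M[R]_(m, n)) (X' : 'M[R]_(m', n'))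
    (Y : 'M[R]_(p, q)) (Y' : 'M[R]_(p', q')) :
  same_mx X X' -> same_mx Y Y' -> same_mx (X *t Y) (X' *t Y').
Proof.
move=> [em [en <-]] [ep [eq <-]].
case: _ / em; case: _ / en; case: _ / ep; case: _ / eq.
by rewrite !castmx_id; exact: same_mx_refl.
Qed.

Lemma same_mx_tensA m n p q r s (X : 'M[R]_(m, n)) (Y : 'M[R]_(p, q))
  (Z : 'M[R]_(r, s)) : same_mx (X *t Y *t Z) (X *t (Y *t Z)).
Proof.
exists (esym (mulnA m p r)), (esym (mulnA n q s)); apply/matrixP => i j.
rewrite castmxE !mxE -mulrA; congr (_ * (_ * _)).
- by congr (X _ _); apply: val_inj => /=; rewrite -divnMA; congr (_ %/ _)%N; exact: mulnC.
- by congr (Y _ _); apply: val_inj => /=; rewrite modn_divl.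
- congr (Z _ _); apply: val_inj => /=; rewrite modn_dvdm //; exact: dvdn_mull.
Qed.

Lemma same_mx_1tens m n (X : 'M[R]_(m, n)) : same_mx X ((1%:M : 'M[R]_1) *t X).
Proof. by rewrite tens_scalar_mx scale1r; exact: same_mx_cast. Qed.

Lemma same_mx_tens1 m n (X : 'M[R]_(m, n)) : same_mx X (X *t (1%:M : 'M[R]_1)).
Proof. by rewrite tens_mx_scalar scale1r; exact: same_mx_cast. Qed.

Lemma same_ntensmxS m n (A : 'M[R]_(m, n)) k :
  same_mx (A *t ntensmx A k) (ntensmx A k.+1).
Proof.
case: k => [|k]; last by rewrite ntensmxSS; exact: same_mx_refl.
by rewrite ntensmx1 ntensmx0; apply: same_mx_sym; exact: same_mx_tens1.
Qed.

Lemma same_ntensmxD m n (A : 'M[R]_(m, n)) k l :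
  same_mx (ntensmx A k *t ntensmx A l) (ntensmx A (k + l)).
Proof.
elim: k => [|k ih].
  by rewrite ntensmx0; apply: same_mx_sym; exact: same_mx_1tens.
apply: same_mx_trans (same_ntensmxS A (k + l)).
apply: same_mx_trans (same_mx_tens (same_mx_refl A) ih).
apply: same_mx_trans (same_mx_tensA _ _ _).
by apply: same_mx_tens (same_mx_refl _); apply: same_mx_sym; exact: same_ntensmxS.
Qed.

(** The dimension equation e is arbitrary, so that it can later be generalised and destructed, which
    removes the cast. *)
Lemma ntensmxS_cast d (A : 'M[R]_d) k (e : (d * d ^ k = d ^ k.+1)%N) :
  ntensmx A k.+1 = castmx (e, e) (A *t ntensmx A k).
Proof.
apply: same_mx_eq; apply: same_mx_trans (same_mx_cast _ _).
exact: same_mx_sym (same_ntensmxS _ _).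
Qed.

Lemma ntensmxD_cast d (A : 'M[R]_d) k l (e : (d ^ k * d ^ l = d ^ (k + l))%N) :
  ntensmx A (k + l) = castmx (e, e) (ntensmx A k *t ntensmx A l).
Proof.
apply: same_mx_eq; apply: same_mx_trans (same_mx_cast _ _).
exact: same_mx_sym (same_ntensmxD _ _ _).
Qed.

Lemma tensmx_scalar m n (a b : R) : (a%:M : 'M[R]_m) *t (b%:M : 'M[R]_n) = (a * b)%:M.
Proof.
by rewrite -[a%:M]scalemx1 -[b%:M]scalemx1 tensmxZl tensmxZr scalerA tensmx11 scalemx1.
Qed.

Lemma ntensmx_scalar d (c : R) k : ntensmx (c%:M : 'M[R]_d) k = (c ^+ k)%:M.
Proof.
elim: k => [|k ih]; first by rewrite ntensmx0.
rewrite (ntensmxS_cast _ (esym (expnS d k))) ih; move: (esym _) => e.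
case: _ / e; by rewrite castmx_id tensmx_scalar exprS.
Qed.

End TensorPowers.

(** * Vectors with vanishing expectation: reference frames for G *)

Section ReferenceFrame.
Variables (C : numClosedFieldType) (d : nat).

(* v is the sum over 0 <= k <= m of the words x^k y^(m - k). *)
Lemma geometric_vector (U : 'M[C]_d) (x y : 'cV[C]_d) (al be : C) m :
  x^t* *m x = 1%:M -> y^t* *m y = 1%:M -> x^t* *m y = 0 ->
  U *m x = al *: x -> U *m y = be *: y ->
  exists v w : 'cV[C]_(d ^ m), exists s : C,
   [/\ v^t* *m v = m.+1%:R%:M, w^t* *m w = 1%:M,
       w^t* *m ntensmx U m *m w = (be ^+ m)%:M,
       v^t* *m ntensmx U m *m v = s%:M &
       s * (al - be) = al ^+ m.+1 - be ^+ m.+1].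
Proof.
move=> xx yy xy Ux Uy.
have yx : y^t* *m x = 0 by rewrite -[y^t* *m x]trmxCK adjmxM trmxCK xy trmx0 map_mx0.
elim: m => [|m [v [w [s [vv ww Uw Uv sE]]]]].
  by exists 1%:M, 1%:M, 1; split; rewrite ?ntensmx0 ?adjmx1 ?mul1mx ?expr1 ?mul1r.
rewrite (ntensmxS_cast _ (esym (expnS d m))); move: (esym _) => e.
case: _ / e; rewrite castmx_id.
suff: exists v w : 'M[C]_(d * d ^ m, 1 * 1), exists s : C,
   [/\ v^t* *m v = m.+2%:R%:M, w^t* *m w = 1%:M,
       w^t* *m (U *t ntensmx U m) *m w = (be ^+ m.+1)%:M,
       v^t* *m (U *t ntensmx U m) *m v = s%:M &
       s * (al - be) = al ^+ m.+2 - be ^+ m.+2] by [].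
(* Prefixing x to every word and adding the word y^(m + 1) gives the next v; s follows the recursion
   of the geometric sum of al^k be^(m - k). *)
exists (x *t v + y *t w), (y *t w), (al * s + be ^+ m.+1); split.
- rewrite adjmxD !adjmx_tens mulmxDl !mulmxDr !tensmx_mul xx xy yx yy !tens0mx.
  by rewrite addr0 add0r vv ww !tensmx_scalar !mul1r -raddfD /= natr1.
- by rewrite adjmx_tens tensmx_mul yy ww tensmx11.
- rewrite adjmx_tens !tensmx_mul -(mulmxA _ U) Uy -scalemxAr yy Uw.
  by rewrite scalemx1 tensmx_scalar exprS.
- rewrite adjmxD !adjmx_tens !mulmxDl !mulmxDr !tensmx_mul -!(mulmxA _ U) Ux Uy.
  rewrite -!scalemxAr xx xy yx yy !scaler0 !tens0mx addr0 add0r Uv Uw.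
  by rewrite !scalemx1 !tensmx_scalar -raddfD /= -exprS.
- by rewrite mulrDl -mulrA sE [in RHS]exprS [be ^+ m.+2]exprS; ring.
Qed.

Lemma unit_column (B : 'M[C]_d) i j : B \is unitarymx ->
  (col i (B^t*))^t* *m col j (B^t*) = (i == j)%:R%:M.
Proof.
move=> /unitarymxP/matrixP/(_ i j); rewrite [in RHS]mxE => e.
apply/matrixP => k l; rewrite !ord1 [RHS]mxE eqxx mulr1n -e !mxE.
by apply: eq_bigr => h _; rewrite !mxE conjCK.
Qed.

(** A non-scalar unitary has two distinct eigenvalues. Here their powers of order q + 1 both equal
    c, so the geometric sum of [geometric_vector] vanishes. *)
Lemma zero_expectation (U : 'M[C]_d) q c : U \is unitarymx ->
  iter q.+1 (mulmx U) 1%:M = c%:M -> (forall z, U != z%:M) ->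
  exists2 v : 'cV[C]_(d ^ q), v^t* *m v = 1%:M & v^t* *m ntensmx U q *m v = 0.
Proof.
move=> uU Uq nU.
have nmU : U \is normalmx.
  by apply/normalmxP; rewrite (unitarymxP uU) unitarymxPl.
have [B uB [z Uz]] : exists2 B : 'M[C]_d, B \is unitarymx & exists z, U = specmx B z.
  exists (spectralmx U); first exact: spectral_unitarymx.
  exists (fun i => spectral_diag U 0 i).
  have /orthomx_spectralP {1}-> := nmU.
  rewrite /specmx (invmx_unitary (spectral_unitarymx U)).
  by congr mulmx; congr mulmx; rewrite /diagR; congr diag_mx; apply/rowP => i; rewrite mxE.
have zq i : z i ^+ q.+1 = c.
  have itE k : iter k (mulmx U) 1%:M = specmx B (fun i => z i ^+ k).
    elim: k => [|k ih]; first by rewrite -(specmx1 uB).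
    by rewrite iterS ih Uz specmxM //; apply: eq_specmx => h; rewrite exprS.
  move: Uq; rewrite itE => /(congr1 (fun X => (B *m X *m B^t*) i i)).
  rewrite /specmx !mulmxA (unitarymxP uB) mul1mx (mulmxtVK _ uB).
  by rewrite mul_mx_scalar -scalemxAl (unitarymxP uB) !mxE eqxx !mulr1n mulr1.
have [[i j] /= zij] : exists ij : 'I_d * 'I_d, z ij.1 != z ij.2.
  have [/existsP//|/existsPn h] := boolP [exists ij : 'I_d * 'I_d, z ij.1 != z ij.2].
  (* If all eigenvalues agree then U is scalar; in dimension 0 there is no eigenvalue to name, but U
     equals the scalar 0. *)
  have [/existsP[i _]|/existsPn d0] := boolP [exists i : 'I_d, true].
    have := nU (z i); rewrite Uz (@eq_specmx _ _ _ _ (fun=> z i * 1)).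
      by rewrite -(specmxZ B (z i)) specmx1 // scalemx1 eqxx.
    by move=> k; have := h (k, i); rewrite negbK mulr1 => /eqP.
  case/negP: (nU 0); apply/eqP/matrixP => i.
  by have := d0 i.
have eig k : U *m col k (B^t*) = z k *: col k (B^t*).
  rewrite !colE Uz /specmx !mulmxA (mulmxtVK _ uB) -mulmxA scalemxAr; congr (_ *m _).
  apply/matrixP => a b; rewrite /diagR mul_diag_mx !mxE.
  by have [->|] := eqVneq a k; rewrite ?mulr0.
have ji : (i == j) = false by apply: contraNF zij => /eqP->.
have on k : (col k (B^t*))^t* *m col k (B^t*) = 1%:M by rewrite unit_column // eqxx.
have ortho : (col i (B^t*))^t* *m col j (B^t*) = 0.
  by rewrite unit_column // ji; apply/matrixP => ? ?; rewrite !mxE mul0rn.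
have [v [_ [s [vv _ _ Uv sE]]]] :=
  geometric_vector q (on i) (on j) ortho (eig i) (eig j).
have s0 : s = 0.
  by move/eqP: sE; rewrite !zq subrr mulf_eq0 subr_eq0 (negbTE zij) orbF => /eqP.
have q0 : 0 < (q.+1%:R : C) by rewrite ltr0n.
exists ((sqrtC q.+1%:R)^-1 *: v); rewrite adjmxZ -!scalemxAl -scalemxAr !scalerA.
  rewrite conj_Creal; last by rewrite ger0_real // invr_ge0 sqrtC_ge0 ltW.
  by rewrite -expr2 exprVn sqrtCK vv scale_scalar_mx mulVf // gt_eqF.
by rewrite Uv s0 -scalemx1 scale0r scaler0.
Qed.

End ReferenceFrame.

Section Frame.
Variables (C : numClosedFieldType) (G : finGroupType) (d : nat).
Variable U : G -> 'M[C]_d.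
Hypothesis repU : proj_rep U.

Lemma proj_rep_ntens n : proj_rep (fun g => ntensmx (U g) n).
Proof.
elim: n => [|n ih].
  split=> [g|g h]; first by apply/unitarymxP; rewrite ntensmx0 adjmx1 mulmx1.
  by exists 1; rewrite ?normr1 // !ntensmx0 mulmx1 scale1r.
(* Naming the whole family before generalising the dimension equation allows that equation to be
   destructed under the binder g. *)
pose W g := ntensmx (U g) n.+1; suff: proj_rep W by [].
have WE g : W g = castmx (_, _) _ := ntensmxS_cast (U g) (esym (expnS d n)).
have [uW mW] := proj_rep_tens repU ih.
move: (esym _) W WE => e; case: _ / e => W WE.
have {}WE g : W g = U g *t ntensmx (U g) n by rewrite WE castmx_id.
by split=> [g|g h]; rewrite !WE; [exact: uW | exact: mW].
Qed.

(** Expectations multiply under tensor products, so one vanishing factor suffices: tensor together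
    one vector for each non-scalar U g. *)
Lemma reference_vector :
  exists m (omega : 'cV[C]_(d ^ m)), omega^t* *m omega = 1%:M /\
    forall g, (exists z, U g = z%:M) \/ omega^t* *m ntensmx (U g) m *m omega = 0.
Proof.
suff H (s : seq G) : exists m (omega : 'cV[C]_(d ^ m)), omega^t* *m omega = 1%:M /\
    forall g, g \in s ->
      (exists z, U g = z%:M) \/ omega^t* *m ntensmx (U g) m *m omega = 0.
  have [m [omega [oo oU]]] := H (enum G).
  by exists m, omega; split=> // g; apply: oU; rewrite mem_enum.
elim: s => [|k s [m [omega [oo oU]]]].
  by exists 0%N, 1%:M; rewrite adjmx1 mulmx1.
have [/is_scalar_mxP kS|kN] := boolP (is_scalar_mx (U k)).
  exists m, omega; split=> // g; rewrite inE => /orP[/eqP->|]; last exact: oU.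
  by left.
(* As k^#|G| = 1, the power #|G| of U k is a scalar, and #|G| - 1 copies suffice for
   [zero_expectation]. *)
have [z Uk] : exists z, iter #|G|.-1.+1 (mulmx (U k)) 1%:M = z%:M.
  rewrite prednK; last by apply/card_gt0P; exists 1%g.
  have [z1 U1] := proj_rep1 repU.
  have [w] : exists w, iter #|G| (mulmx (U k)) 1%:M *m U 1%g = w *: U (k ^+ #|G|)%g.
    elim: #|G| => [|n [w ih]]; first by exists 1; rewrite mul1mx scale1r.
    have [w' _ e] := proj2 repU k (k ^+ n)%g.
    by exists (w * w'); rewrite iterS -mulmxA ih -scalemxAr e scalerA expgS.
  have -> : (k ^+ #|G|)%g = 1%g.
    by rewrite -cardsT expg_cardG ?inE.
  move=> /(congr1 (fun X => X *m (U 1%g)^t*)).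
  rewrite -mulmxA -scalemxAl (unitarymxP (proj1 repU 1%g)) mulmx1 scalemx1 => ->.
  by exists w.
have [|v vv vU] := zero_expectation (proj1 repU k) Uk.
  by move=> w; apply: contraNneq kN => ->; exact: scalar_mx_is_scalar.
pose n := #|G|.-1; exists (n + m)%N.
pose W g := ntensmx (U g) (n + m).
suff: exists om : 'cV[C]_(d ^ (n + m)), om^t* *m om = 1%:M /\
    forall g, g \in k :: s -> (exists z, U g = z%:M) \/ om^t* *m W g *m om = 0.
  by [].
have E g : W g = castmx (_, _) _ := ntensmxD_cast (U g) (esym (expnD d n m)).
move: (esym _) W E => e; case: _ / e => W E.
have {}E g : W g = ntensmx (U g) n *t ntensmx (U g) m by rewrite E castmx_id.
suff: exists om : 'M[C]_(d ^ n * d ^ m, 1 * 1), om^t* *m om = 1%:M /\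
    forall g, g \in k :: s -> (exists z, U g = z%:M) \/ om^t* *m W g *m om = 0.
  by [].
exists (v *t omega); rewrite adjmx_tens tensmx_mul vv oo tensmx11; split=> // g.
rewrite E !tensmx_mul inE => /orP[/eqP->|/oU[|->]]; [|by left|].
- by right; rewrite vU tens0mx.
- by right; rewrite tensmx0.
Qed.

End Frame.

(** * Spectral tests *)

Section SpectralTests.
Variable C : numClosedFieldType.

(* E is the spectral projection of K onto its eigenvalues <= c + a. *)
Lemma spectral_chebyshev n (K : 'M[C]_n) (a b c : C) :
  K^t* = K -> 0 < a -> c \is Num.real -> psd (b%:M - K) -> b \is Num.real ->
  exists E, [/\ projector E, forall X, comm_mx X K -> comm_mx X E,
    psd ((c + a) *: E + b *: (1%:M - E) - K) &
    forall s, psd s -> a ^+ 2 * \tr (s *m (1%:M - E)) <=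
      \tr (s *m ((K - c%:M) *m (K - c%:M)))].
Proof.
move=> hK a0 cR pb bR; have [B uB [f fR fK]] := hermitian_spectral hK.
have aR : a \is Num.real by rewrite gtr0_real.
pose p i := f i <= c + a.
exists (specmx B (fun i => (p i)%:R)); split.
- exact: projector_specmx.
- move=> X; rewrite fK => cX.
  exact: (@comm_specmx _ _ _ uB X f (fun x => (x <= c + a)%R%:R) cX).
- rewrite (scalar_specmx uB 1) specmxB fK !specmxZ specmxD specmxB; apply: psd_specmx => i.
  have fb : 0 <= b - f i.
    apply: (@psd_specmx_ge0 _ _ B (fun i => b - f i) i uB).
    by rewrite -specmxB -(scalar_specmx uB) -fK.
  rewrite /p; case: (boolP (f i <= c + a)) => h /=.
    by rewrite subrr mulr0 mulr1 addr0 subr_ge0.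
  by rewrite mulr0 subr0 mulr1 add0r.
(* Pointwise, a^2 times the indicator of f > c + a is at most (f - c)^2. *)
- move=> s ps; rewrite -subr_ge0 -mxtraceZ -raddfB /= scalemxAr -mulmxBr.
  apply: mxtrace_psd_ge0 => //.
  rewrite (scalar_specmx uB 1) specmxB specmxZ fK (scalar_specmx uB c) !specmxB (specmxM uB) specmxB.
  apply: psd_specmx => i.
  rewrite /p; case: (boolP (f i <= c + a)) => h /=.
    by rewrite subrr mulr0 subr0 -expr2 real_exprn_even_ge0 // realB.
  rewrite subr0 mulr1 -expr2 subr_ge0 lerXn2r ?nnegrE //; first exact: ltW.
    rewrite subr_ge0; apply: le_trans (_ : c + a <= _); first by rewrite lerDl ltW.
    by rewrite ltW // real_ltNge // realD.
  by rewrite lerBrDl ltW // real_ltNge // realD.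
Qed.

Lemma specmx_tens m n (B : 'M[C]_m) (B' : 'M[C]_n) f g :
  specmx B f *t specmx B' g = specmx (B *t B')
    (fun k => f (mxtens_unindex k).1 * g (mxtens_unindex k).2).
Proof.
rewrite /specmx -!tensmx_mul adjmx_tens; congr (_ *m _ *m _).
apply/matrixP => i j; case: (mxtens_indexP i) => i0 i1.
case: (mxtens_indexP j) => j0 j1; rewrite tensmxE !mxE !mxtens_indexK /=.
rewrite (inj_eq (can_inj (@mxtens_indexK m n))) xpair_eqE.
by do 2!case: eqP; rewrite ?mulr1n ?mulr0n ?mul0r ?mulr0.
Qed.

Lemma unitarymx_tens m n (B : 'M[C]_m) (B' : 'M[C]_n) :
  B \is unitarymx -> B' \is unitarymx -> B *t B' \is unitarymx.
Proof.
move=> /unitarymxP u /unitarymxP u'; apply/unitarymxP.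
by rewrite adjmx_tens tensmx_mul u u' tensmx11.
Qed.

Lemma psd_ntens d (rho : 'M[C]_d) n : psd rho -> psd (ntensmx rho n).
Proof.
move=> p; elim: n => [|n ih]; first by rewrite ntensmx0; exact: (projector_psd (projector1 _ _)).
rewrite (ntensmxS_cast _ (esym (expnS d n))); move: (esym _) => e.
by case: _ / e; rewrite castmx_id; exact: psd_tens.
Qed.

Lemma mxtrace_ntens d (rho : 'M[C]_d) n : \tr (ntensmx rho n) = \tr rho ^+ n.
Proof.
elim: n => [|n ih]; first by rewrite ntensmx0 mxtrace1.
rewrite (ntensmxS_cast _ (esym (expnS d n))); move: (esym _) => e.
by case: _ / e; rewrite castmx_id mxtrace_tens ih exprS.
Qed.

(** Eigenvalues are carried as squares because the sum of their square roots is what the likelihood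
    test needs, and it is multiplicative. *)
Lemma spectrum_ntens d (B : 'M[C]_d) s n : B \is unitarymx ->
  (forall i, 0 <= s i) ->
  exists2 B' : 'M[C]_(d ^ n), B' \is unitarymx & exists s',
    [/\ forall i, 0 <= s' i, \sum_i s' i = (\sum_i s i) ^+ n &
     ntensmx (specmx B (fun i => s i ^+ 2)) n = specmx B' (fun i => s' i ^+ 2)].
Proof.
move=> uB s0; elim: n => [|n [B' uB' [s' [s0' sum' E]]]].
  exists 1%:M; first by apply/unitarymxP; rewrite adjmx1 mulmx1.
  exists (fun=> 1); split=> //; first by rewrite big_ord1.
  rewrite ntensmx0 (@eq_specmx _ _ _ _ (fun=> 1)) => [|i]; last by rewrite expr1n.
  by rewrite specmx1 //; apply/unitarymxP; rewrite adjmx1 mulmx1.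
rewrite (ntensmxS_cast _ (esym (expnS d n))); move: (esym _) => e.
case: _ / e; rewrite castmx_id; exists (B *t B'); first exact: unitarymx_tens.
exists (fun k => s (mxtens_unindex k).1 * s' (mxtens_unindex k).2); split.
- by move=> k; exact: mulr_ge0.
- by rewrite exprS -sum' mulr_sum.
- by rewrite E specmx_tens; apply: eq_specmx => k; rewrite exprMn.
Qed.

(* The likelihood ratio test between rho^(x) r and the maximally mixed state: E
   keeps the eigenvalues >= d^-r of rho^(x) r, and both errors are bounded by
   the r-th power of F = sum_i sqrt (p_i / d), p_i being the eigenvalues of
   rho; F < 1 by Cauchy-Schwarz. *)
Lemma likelihood_test d (rho : 'M[C]_d) : psd rho -> \tr rho = 1 ->
  (forall z, rho != z%:M) ->
  exists F, [/\ 0 <= F, F < 1 & forall r, exists E : 'M[C]_(d ^ r),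
    [/\ projector E, \tr E <= F ^+ r * d%:R ^+ r &
     \tr (ntensmx rho r *m (1%:M - E)) <= F ^+ r]].
Proof.
move=> p tr1 ns; have [B uB [f f0 fE]] := psd_spectral p.
pose s i := sqrtC (f i); have s0 i : 0 <= s i by rewrite sqrtC_ge0.
have rhoE : rho = specmx B (fun i => s i ^+ 2).
  by rewrite fE; apply: eq_specmx => i; rewrite sqrtCK.
have sum1 : \sum_i s i ^+ 2 = 1 by rewrite -tr1 rhoE mxtrace_specmx.
have d0 : 0 < (d%:R : C).
  rewrite ltr0n; case: d rho tr1 {p ns B uB f f0 fE s s0 rhoE sum1} => // rho.
  by rewrite /mxtrace big_ord0 => /eqP; rewrite eq_sym oner_eq0.
pose q : C := sqrtC d%:R; have q0 : 0 < q by rewrite sqrtC_gt0.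
pose S := \sum_i s i; have S0 : 0 <= S by exact: sumr_ge0.
exists (S / q); split; first by rewrite divr_ge0 // ltW.
- rewrite ltr_pdivrMr // mul1r -(@ltr_pXn2r _ 2) ?nnegrE ?(ltW q0) // sqrtCK.
  (* The variance of the s i is 1 - F^2. If it were zero, all eigenvalues of rho would be equal and
     rho scalar. *)
  have var : \sum_i (s i - S / d%:R) ^+ 2 = 1 - S ^+ 2 / d%:R.
    set c := S / d%:R.
    rewrite (eq_bigr (fun i => s i ^+ 2 - (2 * c) * s i + c ^+ 2)) => [|i _]; last by ring.
    rewrite big_split /= sumrB -mulr_sumr sum1 sumr_const card_ord -/S -mulr_natr /c.
    by field; rewrite gt_eqF.
  have var0 : 0 <= 1 - S ^+ 2 / d%:R.
    rewrite -var; apply: sumr_ge0 => i _; rewrite real_exprn_even_ge0 // realB //.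
      exact: ger0_real.
    by rewrite ger0_real // divr_ge0 // ltW.
  rewrite lt_def; move: var0; rewrite subr_ge0 ler_pdivrMr // mul1r => ->.
  rewrite andbT; apply/eqP => dS.
  have : \sum_i (s i - S / d%:R) ^+ 2 == 0.
    by rewrite var -dS divff ?subrr // gt_eqF.
  rewrite psumr_eq0 => [/allP h|i _]; last first.
    by rewrite real_exprn_even_ge0 // realB // ger0_real // divr_ge0 // ltW.
  have /negP[] := ns ((S / d%:R) ^+ 2); apply/eqP.
  rewrite rhoE -[RHS]scalemx1 -(specmx1 uB) specmxZ; apply: eq_specmx => i.
  have := h i (mem_index_enum _); rewrite /= sqrf_eq0 subr_eq0 => /eqP ->.
  by rewrite mulr1.
- move=> r; have [B' uB' [s' [s0' sum' E]]] := spectrum_ntens r uB s0.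
  have qr : 0 < q ^+ r by exact: exprn_gt0.
  have qd : d%:R = q ^+ 2 by rewrite sqrtCK.
  (* Both errors are Markov bounds: the indicator of P is at most s' q^r, and off P one has s'^2 <=
     s' / q^r. *)
  pose P i := 1 <= s' i * q ^+ r.
  exists (specmx B' (fun i => (P i)%:R)); split; first exact: projector_specmx.
    rewrite mxtrace_specmx // expr_div_n -sum' qd -exprM mulnC exprM.
    rewrite expr2 mulrA divfK ?gt_eqF // mulr_suml; apply: ler_sum => i _.
    by rewrite /P; case: (boolP (1 <= _)) => //= _; rewrite mulr_ge0 // ltW.
  rewrite rhoE E -(specmx1 uB') -[- specmx _ _]scaleN1r specmxZ specmxD.
  rewrite specmxM // mxtrace_specmx // expr_div_n -sum' mulr_suml.
  apply: ler_sum => i _; rewrite /P; case: (boolP (1 <= _)) => [_|h] /=.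
    by rewrite mulr1 subrr mulr0 divr_ge0 // ltW.
  rewrite mulr0 addr0 mulr1 expr2 ler_wpM2l //.
  rewrite -[X in _ <= X]mul1r ler_pdivlMr // ltW // real_ltNge //.
  by rewrite ger0_real // mulr_ge0 // ltW.
Qed.

End SpectralTests.

(** * Work extraction by invariant unitaries *)

Lemma psd_scalar (C : numClosedFieldType) n (z : C) : 0 <= z -> psd (z%:M : 'M[C]_n).
Proof.
move=> z0; have -> : z%:M = (sqrtC z)%:M *m ((sqrtC z)%:M : 'M[C]_n)^t*.
  rewrite tr_scalar_mx map_scalar_mx /= conj_Creal ?ger0_real ?sqrtC_ge0 //.
  by rewrite -scalar_mxM -expr2 sqrtCK.
exact: psd_mul_adj.
Qed.

Section InvariantExtraction.
Variables (C : numClosedFieldType) (G : finGroupType) (a1 a2 b : nat).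
Variables (A1 : G -> 'M[C]_a1) (A2 : G -> 'M[C]_a2) (A3 : G -> 'M[C]_b).
Hypotheses (repA1 : proj_rep A1) (repA2 : proj_rep A2) (repA3 : proj_rep A3).
Variables (r1 K1 : 'M[C]_a1) (r2 K2 : 'M[C]_a2) (r3 K3 : 'M[C]_b).
Hypotheses (psd1 : psd r1) (psd2 : psd r2) (psd3 : psd r3).
Hypotheses (tr1 : \tr r1 = 1) (tr2 : \tr r2 = 1) (tr3 : \tr r3 = 1).
Let W g := A1 g *t A2 g *t A3 g.
Let r := r1 *t r2 *t r3.
Let K := (K1 *t 1%:M + 1%:M *t K2) *t 1%:M + 1%:M *t K3.

(** [invariant_swap] carries the range of T (x) P (x) 1 into that of E (x) (1 - P) (x) 1. They are
    orthogonal through P, and the trace inequality is the dimension count. The first system thus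
    ends in E with weight at least p, costing x there and y elsewhere; z2 and z3 bound the other two
    systems. *)
Lemma invariant_extraction (omega : 'cV[C]_b) (E T : 'M[C]_a1) (P : 'M[C]_a2)
    (p x y z2 z3 : C) :
  omega^t* *m omega = 1%:M ->
  (forall g, (exists z, W g = z%:M) \/ omega^t* *m A3 g *m omega = 0) ->
  projector E -> (forall g, comm_mx E (A1 g)) ->
  projector T -> (forall g, comm_mx T (A1 g)) ->
  projector P -> (forall g, comm_mx P (A2 g)) ->
  \tr T * \tr P * b%:R <= \tr E * (a2%:R - \tr P) ->
  psd (x *: E + y *: (1%:M - E) - K1) ->
  psd (z2%:M - K2) -> psd (z3%:M - K3) ->
  x <= y -> p <= \tr (r1 *m T) * \tr (r2 *m P) ->
  exists V, [/\ V \is unitarymx, forall g, comm_mx V (W g) &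
    \tr (V *m r *m V^t* *m K) <= y - (y - x) * p + z2 + z3].
Proof.
move=> oo oW pE cE pT cT pP cP dimle pK1 pK2 pK3 xy pTP.
have [hP PP] := pP; have pE2 := projector_tens pE (projectorC pP).
have repA12 := proj_rep_tens repA1 repA2.
have pT3 := projector_tens (projector_tens pT pP) (projector1 C b).
have [||||V [uV cV EV]] := @invariant_swap C G _ _ _ _ repA12 repA3 omega
   (T *t P *t 1%:M) (E *t (1%:M - P)) oo oW pT3 _ pE2.
- by move=> g; rewrite /comm_mx !tensmx_mul cT cP mul1mx mulmx1.
- move=> g; rewrite /comm_mx !tensmx_mul cE.
  by rewrite mulmxBl mulmxBr mul1mx mulmx1 cP.
- by rewrite !tensmx_mul mulmxBl mul1mx PP subrr tensmx0 tens0mx.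
- by rewrite !mxtrace_tens raddfB /= !mxtrace1.
exists V; split=> //; set t := V *m r *m V^t*.
have pr : psd r by do 2!apply: psd_tens => //.
have pt : psd t by exact: psd_conj.
have trr : \tr r = 1 by rewrite !mxtrace_tens tr1 tr2 tr3 !mulr1.
have trt : \tr t = 1 by rewrite /t mxtrace_mulC mulmxA unitarymxPl // mul1mx.
have pE3 := projector_tens pE2 (projector1 C b).
pose E3 : 'M[C]_(a1 * a2 * b) := E *t 1%:M *t 1%:M.
have pE4 : projector E3.
  exact: projector_tens (projector_tens pE (projector1 _ _)) (projector1 _ _).
(* V^* F V dominates T (x) P (x) 1, because V maps that range into the range of F, and F lies below
   E3. *)
have tp : p <= \tr (t *m E3).
  apply: le_trans pTP _.
  have -> : \tr (r1 *m T) * \tr (r2 *m P) = \tr (r *m (T *t P *t 1%:M)).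
    by rewrite !tensmx_mul !mxtrace_tens mulmx1 tr3 mulr1.
  apply: (@le_trans _ _ (\tr (t *m (E *t (1%:M - P) *t 1%:M)))); last first.
    apply: mxtrace_projector_le => //.
    by rewrite !tensmx_mul !mul1mx (proj2 pE).
  set F := _ *t 1%:M in EV pE3 *; have [hF FF] := pE3.
  have -> : \tr (t *m F) = \tr (r *m (V^t* *m F *m V)).
    by rewrite /t -!mulmxA mxtrace_mulC !mulmxA.
  apply: mxtrace_projector_le => //; last first.
    by rewrite -!mulmxA [F *m (V *m _)]mulmxA EV mulmxA unitarymxPl // mul1mx.
  split; first by rewrite !adjmxM trmxCK hF mulmxA.
  by rewrite !mulmxA (mulmxtVK _ uV) -(mulmxA _ F F) FF.
(* The three operator bounds, tensored with identities, are traced against t and added. *)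
have := mxtrace_psd_ge0 pt (psd_tens (psd_tens pK1 (projector_psd (projector1 C a2)))
   (projector_psd (projector1 C b))).
have := mxtrace_psd_ge0 pt (psd_tens (psd_tens (projector_psd (projector1 C a1)) pK2)
   (projector_psd (projector1 C b))).
have := mxtrace_psd_ge0 pt (psd_tens (projector_psd (projector1 C (a1 * a2))) pK3).
rewrite !(tensmxBl, tensmxBr, tensmxDl, tensmxDr, tensmxZl, tensmxZr).
rewrite -[z2%:M]scalemx1 -[z3%:M]scalemx1.
rewrite !(tensmxBl, tensmxBr, tensmxDl, tensmxDr, tensmxZl, tensmxZr) !tensmx11.
rewrite !(mulmxBr, mulmxDr) -!scalemxAr !mulmxBr !mulmx1 -/E3.
have trB m (X Y : 'M[C]_m) : \tr (X - Y) = \tr X - \tr Y by rewrite raddfB.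
rewrite !(trB, mxtraceD, mxtraceZ) trt tensmxDl mulmxDr mxtraceD.
set k1 := \tr (t *m (K1 *t _ *t _)); set k2 := \tr (t *m (_ *t K2 *t _)).
set k3 := \tr (t *m (_ *t K3)); set e := \tr _ in tp *.
move=> h3 h2 h1; rewrite -subr_ge0.
have -> : y - (y - x) * p + z2 + z3 - (k1 + k2 + k3) =
  (x * e + y * (1 - e) - k1) + (z2 * 1 - k2) + (z3 * 1 - k3) + (y - x) * (e - p) by ring.
apply: addr_ge0; last by rewrite mulr_ge0 // subr_ge0.
by apply: addr_ge0 => //; exact: addr_ge0.
Qed.

End InvariantExtraction.

(** * Additive observables and the energy of independent copies *)

Section AdditiveObservable.
Variables (C : numClosedFieldType) (d : nat).
Implicit Type K : forall n, 'M[C]_(d ^ n).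

(** Abstracts the total Hamiltonian; its negative, used to bound energies from below, is covered
    too. *)
Definition additive_observable K : Prop :=
  K 0%N = 0 /\ forall m n, same_mx (K m *t 1%:M + 1%:M *t K n) (K (m + n)%N).

Lemma same_mx_castE (R : comPzRingType) m n m' n' (X : 'M[R]_(m, n)) (Y : 'M[R]_(m', n'))
  em en : same_mx X Y -> Y = castmx (em, en) X.
Proof.
move=> [em' [en' <-]].
by rewrite (eq_irrelevance em em') (eq_irrelevance en en').
Qed.

Lemma additive_observable_adj K : additive_observable K ->
  (K 1%N)^t* = K 1%N -> forall n, (K n)^t* = K n.
Proof.
move=> [K0 KD] h1; elim=> [|n ih]; first by rewrite K0 trmx0 map_mx0.
have /same_mx_castE -/(_ (esym (expnS d n)) (esym (expnS d n))) E := KD 1%N n.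
rewrite -[n.+1]/(1 + n)%N E; rewrite adjmx_cast; congr castmx.
by rewrite adjmxD !adjmx_tens !adjmx1 ih h1.
Qed.

Lemma additive_observable_comm K (U : 'M[C]_d) : additive_observable K ->
  comm_mx (U : 'M[C]_(d ^ 1)) (K 1%N) -> forall n, comm_mx (ntensmx U n) (K n).
Proof.
move=> [K0 KD] h1; elim=> [|n ih]; first by rewrite K0; exact: comm_mx0.
have /same_mx_castE -/(_ (esym (expnS d n)) (esym (expnS d n))) := KD 1%N n.
rewrite -[n.+1]/(1 + n)%N.
have := same_mx_castE (esym (expnS d n)) (esym (expnS d n)) (same_ntensmxD U 1 n).
rewrite ntensmx1; move: (esym _) (K (1 + n)%N) (ntensmx U (1 + n)) => e.
case: _ / e => L W -> ->; rewrite !castmx_id /comm_mx mulmxDl mulmxDr !tensmx_mul.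
by rewrite !mul1mx !mulmx1 h1 ih.
Qed.

Lemma additive_observable_le K (z : C) : additive_observable K ->
  psd (z%:M - K 1%N) -> forall n, psd ((n%:R * z)%:M - K n).
Proof.
move=> [K0 KD] h1; elim=> [|n ih].
  rewrite K0 mul0r subr0 -scalemx1 scale0r; split.
    by rewrite trmx0 map_mx0.
  by move=> u; rewrite mulmx0 mul0mx mxE.
have /same_mx_castE -/(_ (esym (expnS d n)) (esym (expnS d n))) := KD 1%N n.
rewrite -[n.+1]/(1 + n)%N; move: (esym _) (K (1 + n)%N) => e.
case: _ / e => L ->; rewrite castmx_id.
have I m := projector_psd (projector1 C m).
have := psdD (psd_tens h1 (I (d ^ n)%N)) (psd_tens (I d) ih).
rewrite tensmxBl tensmxBr !tensmx_scalar mulr1 mul1r.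
by rewrite natrD mulrDl mul1r raddfD /= opprD addrACA.
Qed.

(* W is the k-th tensor power of W0. *)
Lemma iid_energy K (rho : 'M[C]_d) n0 (W0 : 'M[C]_(d ^ n0)) e v :
  additive_observable K -> \tr rho = 1 -> W0 \is unitarymx ->
  let s := W0 *m ntensmx rho n0 *m W0^t* in
  \tr (s *m (K n0 - e%:M)) = 0 ->
  \tr (s *m ((K n0 - e%:M) *m (K n0 - e%:M))) = v ->
  forall k, exists2 W : 'M[C]_(d ^ (k * n0)), W \is unitarymx &
    let sk := W *m ntensmx rho (k * n0) *m W^t* in
    let B := K (k * n0)%N - (k%:R * e)%:M in
    \tr (sk *m B) = 0 /\ \tr (sk *m (B *m B)) = k%:R * v.
Proof.
move=> [K0 KD] trr uW0 s s1 s2; elim=> [|k [W uW [ih1 ih2]]].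
  exists 1%:M; first by apply/unitarymxP; rewrite adjmx1 mulmx1.
  have -> : K (0 * n0)%N - (0%:R * e)%:M = 0.
    by rewrite [K _]K0 mul0r sub0r -scalemx1 scale0r oppr0.
  by rewrite /= !mulmx0 mxtrace0 mul0r.
have tr_conj m (X : 'M[C]_(d ^ m)) : X \is unitarymx ->
    \tr (X *m ntensmx rho m *m X^t*) = 1.
  by move=> uX; rewrite mxtrace_mulC mulmxA unitarymxPl // mul1mx mxtrace_ntens trr expr1n.
rewrite mulSn; move: (k * n0)%N W uW ih1 ih2 => m W uW.
have /same_mx_castE -/(_ (esym (expnD d n0 m)) (esym (expnD d n0 m))) := KD n0 m.
have := same_mx_castE (esym (expnD d n0 m)) (esym (expnD d n0 m)) (same_ntensmxD rho n0 m).
move: (esym _) (K (n0 + m)%N) (ntensmx rho (n0 + m)) => eq.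
case: _ / eq => r L -> ->; rewrite !castmx_id.
set t := W *m _ *m _; set B' := K m - _ => t1 t2.
pose B := K n0 - e%:M.
exists (W0 *t W); first exact: unitarymx_tens.
rewrite adjmx_tens !tensmx_mul -/s -/t /=.
have -> : K n0 *t 1%:M + 1%:M *t K m - (k.+1%:R * e)%:M = B *t 1%:M + 1%:M *t B'.
  rewrite tensmxBl tensmxBr !tensmx_scalar addrACA -opprD -raddfD /=.
  by rewrite mulr1 mul1r -natr1 mulrDl mul1r [e + _]addrC.
have trs : \tr s = 1 by exact: tr_conj.
have trt : \tr t = 1 by exact: tr_conj.
split.
  by rewrite mulmxDr !tensmx_mul !mulmx1 mxtraceD !mxtrace_tens s1 t1 mulr0 mul0r addr0.
(* The cross terms of the square vanish because both factors are centred, so variances add. *)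
rewrite mulmxDl !mulmxDr !tensmx_mul !mul1mx !mulmx1.
rewrite !mxtraceD !mxtrace_tens s1 s2 t1 t2 trs trt.
by rewrite -natr1; ring.
Qed.

End AdditiveObservable.

(** * Invariant work extraction from finitely many copies *)

Section FiniteWork.
Variables (C : numClosedFieldType) (G : finGroupType) (d : nat).
Variables (U : G -> 'M[C]_d) (rho : 'M[C]_d) (K : forall n, 'M[C]_(d ^ n)).
Hypotheses (repU : proj_rep U) (psdr : psd rho) (trr : \tr rho = 1).
Hypotheses (addK : additive_observable K) (hK : (K 1%N)^t* = K 1%N).
Hypothesis cK : forall g, comm_mx (U g : 'M[C]_(d ^ 1)) (K 1%N).

(** The energy of k copies of s has variance k v, so at most v / (k eta^2) <= delta of the weight
    lies above k (e + eta). P loses another delta, whence 2 * delta. A failure costs at most k (n0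
    beta - e) more, and each extra copy at most beta. *)
Lemma finite_invariant_work (beta e v eta delta : C) n0 (W0 : 'M[C]_(d ^ n0))
    m (omega : 'cV[C]_(d ^ m)) r (P : 'M[C]_(d ^ r)) k :
  psd (beta%:M - K 1%N) -> W0 \is unitarymx ->
  let s := W0 *m ntensmx rho n0 *m W0^t* in
  \tr (s *m K n0) = e -> \tr (s *m ((K n0 - e%:M) *m (K n0 - e%:M))) = v ->
  beta \is Num.real -> e \is Num.real ->
  omega^t* *m omega = 1%:M ->
  (forall g, (exists z, U g = z%:M) \/ omega^t* *m ntensmx (U g) m *m omega = 0) ->
  projector P -> (forall g, comm_mx P (ntensmx (U g) r)) ->
  (#|G|%:R * (d ^ m)%:R + 1) * \tr P <= (d ^ r)%:R ->
  1 - delta <= \tr (ntensmx rho r *m P) ->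
  0 < delta -> delta < 1 -> 0 < eta -> (0 < k)%N -> v <= delta * (k%:R * eta ^+ 2) ->
  exists V : 'M[C]_(d ^ (k * n0 + r + m)),
    [/\ V \is unitarymx, forall g, comm_mx V (ntensmx (U g) (k * n0 + r + m)) &
     \tr (V *m ntensmx rho (k * n0 + r + m) *m V^t* *m K (k * n0 + r + m)%N) <=
     k%:R * (e + eta + (n0%:R * beta - e) * (2 * delta)) + (r + m)%:R * beta].
Proof.
move=> pK uW0 s se sv bR eR oo oU pP cP dimP trP de0 de1 eta0 k0 vle.
have prn n : psd (ntensmx rho n) by exact: psd_ntens.
have trn n : \tr (ntensmx rho n) = 1 by rewrite mxtrace_ntens trr expr1n.
have pKn := additive_observable_le addK pK.
have trs : \tr s = 1 by rewrite mxtrace_mulC mulmxA unitarymxPl // mul1mx.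
have s1 : \tr (s *m (K n0 - e%:M)) = 0.
  by rewrite mulmxBr raddfB /= se mul_mx_scalar mxtraceZ trs mulr1 subrr.
have [W uW [t1 t2]] := iid_energy addK trr uW0 s1 sv k.
set n := (k * n0)%N in W uW t1 t2 *.
set t := W *m _ *m _ in t1 t2.
have pt : psd t by exact: psd_conj.
have kR : 0 < (k%:R : C) by rewrite ltr0n.
have keta : 0 < k%:R * eta by rewrite mulr_gt0.
(* The ceiling of [K n] is raised by k eta so that it exceeds the threshold k e + k eta by exactly k
   (n0 beta - e). *)
have pKy : psd ((n%:R * beta + k%:R * eta)%:M - K n).
  by rewrite raddfD /= addrAC; apply: psdD (pKn n) (psd_scalar _ _); exact: ltW.
have keR : k%:R * e \is Num.real by rewrite realM // realn.
have nbR j : j%:R * beta \is Num.real by rewrite realM // realn.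
have [E [pE cE pKE cheb]] := spectral_chebyshev (additive_observable_adj addK hK n)
  keta keR pKy (realD (nbR n) (gtr0_real keta)).
have trE : 1 - delta <= \tr (t *m E).
  have := cheb t pt; rewrite t2 mulmxBr raddfB /= mulmx1.
  have -> : \tr t = 1 by rewrite mxtrace_mulC mulmxA unitarymxPl // mul1mx trn.
  move=> h; rewrite lerBlDl -lerBlDr.
  rewrite -(@ler_pM2l _ ((k%:R * eta) ^+ 2)) ?exprn_gt0 //; apply: le_trans h _.
  rewrite exprMn expr2 -!mulrA ler_pM2l //; apply: le_trans vle _.
  by rewrite le_eqVlt; apply/orP; left; apply/eqP; ring.
have comU j g : comm_mx (ntensmx (U g) j) (K j).
  exact: additive_observable_comm.
have repn j := proj_rep_ntens repU j.
have cEU g : comm_mx E (ntensmx (U g) n) by apply/comm_mx_sym/cE.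
(* The preimage of E under W carries the weight of rho that W sends to low energy; T is its
   invariant hull. *)
have pE0 : projector (W^t* *m E *m W).
  have [hE EE] := pE; split; first by rewrite !adjmxM trmxCK hE mulmxA.
  by rewrite !mulmxA (mulmxtVK _ uW) -(mulmxA _ E E) EE.
have [T [pT TE trT cT]] := invariant_support (repn n) pE0.
have trTr : 1 - delta <= \tr (ntensmx rho n *m T).
  apply: le_trans trE _; apply: (@le_trans _ _ (\tr (ntensmx rho n *m (W^t* *m E *m W)))).
    by rewrite /t -!mulmxA mxtrace_mulC !mulmxA.
  exact: mxtrace_projector_le.
have trE0 : \tr (W^t* *m E *m W) = \tr E.
  by rewrite mxtrace_mulC mulmxA (unitarymxP uW) mul1mx.
have ge0tr j (Q : 'M[C]_j) : projector Q -> 0 <= \tr Q.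
  by move=> /mxtrace_projector->; exact: ler0n.
have ler_e : e <= n0%:R * beta.
  have := mxtrace_psd_ge0 (psd_conj W0 (prn n0)) (pKn n0).
  by rewrite mulmxBr raddfB /= se mul_mx_scalar mxtraceZ trs mulr1 subr_ge0.
(* The summand 1 in the dimension hypothesis pays for the trace of P subtracted on the right; the
   factor #|G| pays for T. *)
have dim : \tr T * \tr P * (d ^ m)%:R <= \tr E * ((d ^ r)%:R - \tr P).
  apply: (@le_trans _ _ (\tr E * (#|G|%:R * (d ^ m)%:R * \tr P))); last first.
    by rewrite ler_wpM2l ?ge0tr // lerBrDr -[X in _ + X]mul1r -mulrDl.
  rewrite (_ : \tr E * _ = #|G|%:R * \tr E * \tr P * (d ^ m)%:R); last by ring.
  by rewrite !ler_wpM2r ?ler0n ?ge0tr // -trE0.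
have pn : 1 - 2 * delta <= \tr (ntensmx rho n *m T) * \tr (ntensmx rho r *m P).
  apply: (@le_trans _ _ ((1 - delta) * (1 - delta))).
    rewrite -subr_ge0 (_ : _ - _ = delta ^+ 2); last by ring.
    by rewrite exprn_ge0 // ltW.
  by apply: ler_pM => //; rewrite subr_ge0 ltW.
have xy : k%:R * e + k%:R * eta <= n%:R * beta + k%:R * eta.
  by rewrite lerD2r natrM -mulrA ler_wpM2l // ler0n.
have dE : (d ^ n * d ^ r * d ^ m = d ^ (n + r + m))%N by rewrite !expnD.
have ntE (X : 'M[C]_d) : ntensmx X (n + r + m) =
    castmx (dE, dE) (ntensmx X n *t ntensmx X r *t ntensmx X m).
  apply: same_mx_castE; apply: same_mx_trans (same_ntensmxD _ _ _).
  exact: same_mx_tens (same_ntensmxD _ _ _) (same_mx_refl _).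
have KE : K (n + r + m)%N = castmx (dE, dE)
    ((K n *t 1%:M + 1%:M *t K r) *t 1%:M + 1%:M *t K m).
  apply: same_mx_castE; apply: same_mx_trans (proj2 addK _ _).
  have := same_mx_castE (esym (expnD d n r)) (esym (expnD d n r)) (proj2 addK n r).
  move: (esym _) (K (n + r)%N) => eq; case: _ / eq => L ->; rewrite castmx_id.
  exact: same_mx_refl.
have [|V [uV cV VK]] := invariant_extraction (repn n) (repn r) (repn m) (prn n) (prn r)
  (prn m) (trn n) (trn r) (trn m) oo _ pE cEU pT cT pP cP dim pKE (pKn r) (pKn m) xy pn.
  move=> g; case: (oU g) => [[z Uz]|]; last by right.
  left; exists (z ^+ n * z ^+ r * z ^+ m).
  by rewrite Uz !ntensmx_scalar !tensmx_scalar.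
move: (ntensmx rho (n + r + m)) (K (n + r + m)%N) (ntE rho) KE => L1 L2 E1 E2.
have {}ntE g := ntE (U g).
pose W' g := ntensmx (U g) (n + r + m).
suff: exists V0, [/\ V0 \is unitarymx, forall g, comm_mx V0 (W' g) &
     \tr (V0 *m L1 *m V0^t* *m L2) <=
     k%:R * (e + eta + (n0%:R * beta - e) * (2 * delta)) + (r + m)%:R * beta] by [].
have WE g : W' g = castmx (_, _) _ := ntE g.
move: W' WE L1 L2 E1 E2 {ntE}; case: _ / dE => W' WE L1 L2 -> ->.
rewrite !castmx_id; exists V; split=> //.
  by move=> g; rewrite WE castmx_id.
apply: le_trans VK _; rewrite le_eqVlt; apply/orP; left; apply/eqP.
by rewrite /n natrM natrD; ring.
Qed.

End FiniteWork.

(** * Asymptotic rates *)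

Section LimSup.
Variable R : realType.
Implicit Type u : nat -> \bar R.
Local Open Scope ereal_scope.
Local Open Scope classical_set_scope.

(** Infinitely many indices suffice, so only sizes of the form k * n0 + c have to be treated. *)
Lemma limn_esup_ge u a : (forall n, exists2 m, (n <= m)%N & a <= u m) ->
  a <= limn_esup u.
Proof.
move=> h; rewrite /limn_esup limf_esupE; apply: le_ereal_inf_tmp => _ [V [n _ nV] <-].
have [m nm um] := h n; apply: le_trans um _; apply: ereal_sup_ubound.
by exists m => //; exact: nV.
Qed.

(** Index 0 is dropped from the tail, since the comparison of rates is made for blocks of positive
    length. *)
Lemma limn_esup_le u a : (forall n, (0 < n)%N -> u n <= a) -> limn_esup u <= a.
Proof.
move=> h; rewrite /limn_esup limf_esupE.
pose V : set nat := [set n | (0 < n)%N].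
apply: (@le_trans _ _ (ereal_sup (u @` V))).
  by apply: ereal_inf_lbound; exists V => //; exists 1%N.
by apply: ge_ereal_sup => _ [n n0 <-]; exact: h.
Qed.

Lemma le_limn_esup u v : (forall n, u n <= v n) -> limn_esup u <= limn_esup v.
Proof.
move=> uv; rewrite /limn_esup !limf_esupE; apply: le_ereal_inf_tmp => _ [V oV <-].
apply: (@le_trans _ _ (ereal_sup (u @` V))).
  by apply: ereal_inf_lbound; exists V.
apply: ge_ereal_sup => _ [n Vn <-]; apply: le_trans (uv n) _.
by apply: ereal_sup_ubound; exists n.
Qed.

End LimSup.

(** * Additivity of the total Hamiltonian *)

Section Hamiltonian.
Variables (R : realType) (d : nat).
Local Notation C := R[i].
Implicit Type H : 'M[C]_d.

Lemma ntensmx1mx n : ntensmx (1%:M : 'M[C]_d) n = 1%:M.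
Proof. by rewrite ntensmx_scalar expr1n. Qed.

Lemma castmxD m m' (e : m = m') (X Y : 'M[C]_m) :
  castmx (e, e) (X + Y) = castmx (e, e) X + castmx (e, e) Y.
Proof. by case: _ / e; rewrite !castmx_id. Qed.

Lemma castmx_tens_sum m m' n (e : (m * n = m')%N) (I : finType) (F : I -> 'M[C]_n) :
  castmx (e, e) ((1%:M : 'M[C]_m) *t \sum_i F i) =
  \sum_i castmx (e, e) ((1%:M : 'M[C]_m) *t F i).
Proof.
case: _ / e; rewrite castmx_id; under [RHS]eq_bigr do rewrite castmx_id.
by elim/big_rec2: _ => [|i X Y _ <-]; rewrite ?tensmx0 ?tensmxDr.
Qed.

Lemma total_hamiltonianS n H (e : (d * d ^ n = d ^ n.+1)%N) :
  total_hamiltonian n.+1 H = castmx (e, e) (H *t 1%:M + 1%:M *t total_hamiltonian n H).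
Proof.
rewrite /total_hamiltonian big_ord_recl castmxD castmx_tens_sum; congr (_ + _).
  apply: same_mx_eq; apply: same_mx_trans (same_mx_sym (same_mx_cast _ _)) _.
  apply: same_mx_trans (same_mx_cast _ _).
  rewrite /= ntensmx0 subn1 /= ntensmx1mx; apply: same_mx_tens (same_mx_refl _).
  exact: same_mx_sym (same_mx_1tens _).
apply: eq_bigr => j _.
apply: same_mx_eq; apply: same_mx_trans (same_mx_sym (same_mx_cast _ _)) _.
apply: same_mx_trans (same_mx_cast _ _); apply: same_mx_sym.
apply: same_mx_trans (same_mx_tens (same_mx_refl _) (same_mx_sym (same_mx_cast _ _))) _.
apply: same_mx_trans (same_mx_sym (same_mx_tensA _ _ _)) _.
apply: same_mx_tens; last exact: same_mx_refl.
apply: same_mx_trans (same_mx_sym (same_mx_tensA _ _ _)) _.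
apply: same_mx_tens (same_mx_refl _).
exact: same_ntensmxS.
Qed.

Lemma total_hamiltonian0 H : total_hamiltonian 0 H = 0.
Proof. by rewrite /total_hamiltonian big_ord0. Qed.

Lemma total_hamiltonian1 H : total_hamiltonian 1 H = H.
Proof.
rewrite (total_hamiltonianS _ (esym (expnS d 0))) total_hamiltonian0 tensmx0 addr0.
apply: same_mx_eq; apply: same_mx_trans (same_mx_sym (same_mx_cast _ _)) _.
exact: same_mx_sym (same_mx_tens1 _).
Qed.

Lemma total_hamiltonian_additive H :
  additive_observable (fun n => total_hamiltonian n H).
Proof.
split=> [|m n]; first exact: total_hamiltonian0.
elim: m => [|m ih].
  rewrite total_hamiltonian0 tens0mx add0r add0n.
  exact: same_mx_sym (same_mx_1tens _).
have ihE := same_mx_castE (esym (expnD d m n)) (esym (expnD d m n)) ih.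
rewrite addSn (total_hamiltonianS _ (esym (expnS d (m + n)))).
rewrite (total_hamiltonianS _ (esym (expnS d m))).
apply: same_mx_trans (same_mx_cast _ _).
move: (total_hamiltonian (m + n) H) ihE; move: (esym (expnD d m n)) => e.
case: _ / e => L ->; rewrite castmx_id {L ih}.
move: (esym (expnS d m)) => e; case: _ / e; rewrite castmx_id.
rewrite tensmxDl tensmxDr addrA.
have sD a a' (X X' : 'M[C]_a) (Y Y' : 'M[C]_a') :
    same_mx X Y -> same_mx X' Y' -> same_mx (X + X') (Y + Y').
  move=> [e1 [e2 <-]] [e3 [e4 <-]]; case: _ / e1 e2 e3 e4 => e2 e3 e4.
  rewrite (eq_irrelevance e2 erefl) (eq_irrelevance e3 erefl).
  by rewrite (eq_irrelevance e4 erefl) !castmx_id; exact: same_mx_refl.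
have h3 := same_mx_tensA (1%:M : 'M[C]_d) (1%:M : 'M[C]_(d ^ m)) (total_hamiltonian n H).
rewrite tensmx11 in h3.
have h1 := same_mx_tensA H (1%:M : 'M[C]_(d ^ m)) (1%:M : 'M[C]_(d ^ n)).
rewrite tensmx11 in h1.
exact: (sD _ _ _ _ _ _ (sD _ _ _ _ _ _ h1 (same_mx_tensA _ _ _)) h3).
Qed.

End Hamiltonian.

(** * Bounds on extracted work and the typical projector *)

Section Work.
Variables (R : realType) (d : nat).
Local Notation C := R[i].
Variables (rho H : 'M[C]_d).
Hypotheses (prho : psd rho) (trrho : \tr rho = 1) (hH : H^t* = H).

Lemma ler_complexRe (x y : C) : x <= y -> complex.Re x <= complex.Re y.
Proof. by rewrite lecE => /andP[]. Qed.

Lemma hermitian_bound (A : 'M[C]_d) : A^t* = A ->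
  exists beta : R, [/\ 0 <= beta, psd (beta%:C%C%:M - A) & psd (beta%:C%C%:M - - A)].
Proof.
move=> hA; have [B uB [f fR fA]] := hermitian_spectral hA.
(* The sum of the absolute eigenvalues bounds each of them and avoids a maximum over a possibly
   empty index set. *)
pose beta := \sum_i `|complex.Re (f i)|.
have b0 : 0 <= beta by apply: sumr_ge0.
have fb i : `|complex.Re (f i)| <= beta.
  by rewrite /beta (bigD1 i) //= lerDl sumr_ge0.
have subB z g : z%:M - specmx B g = specmx B (fun i => z - g i).
  by rewrite (scalar_specmx uB) specmxB.
have nA : - A = specmx B (fun i => - f i).
  by rewrite fA -scaleN1r specmxZ; apply: eq_specmx => i; rewrite mulN1r.
exists beta; split; first exact: b0.
  rewrite fA subB; apply: psd_specmx => i.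
  rewrite -(RRe_real (fR i)) subr_ge0 lecR.
  exact: le_trans (ler_norm _) (fb i).
rewrite nA subB; apply: psd_specmx => i.
rewrite opprK -(RRe_real (fR i)) -rmorphD lecR -lerBlDr sub0r.
by apply: le_trans (fb i); rewrite -normrN ler_norm.
Qed.

Lemma additive_observable_opp (K : forall n, 'M[C]_(d ^ n)) :
  additive_observable K -> additive_observable (fun n => - K n).
Proof.
move=> [K0 KD]; split=> [|m n]; first by rewrite K0 oppr0.
have [em [en E]] := KD m n; exists em, en; rewrite -E.
rewrite -(scaleN1r (K m)) -(scaleN1r (K n)) tensmxZl tensmxZr -scalerDr scaleN1r.
by case: _ / em en {E} => en; rewrite (eq_irrelevance en erefl) !castmx_id.
Qed.

Lemma mxtrace_total_hamiltonian n :
  \tr (ntensmx rho n *m total_hamiltonian n H) = n%:R * \tr (rho *m H).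
Proof.
elim: n => [|n ih]; first by rewrite total_hamiltonian0 mulmx0 mxtrace0 mul0r.
rewrite (total_hamiltonianS _ (esym (expnS d n))) (ntensmxS_cast _ (esym (expnS d n))).
move: (esym _) => e; case: _ / e; rewrite !castmx_id mulmxDr !tensmx_mul !mulmx1.
rewrite mxtraceD !mxtrace_tens ih mxtrace_ntens trrho expr1n -natr1; ring.
Qed.

(** The final energy is at least -n b, so the sets of extracted works are bounded above and their
    [sup] is an upper bound. *)
Lemma extracted_work_bound n : exists M, forall V : 'M[C]_(d ^ n),
  V \is unitarymx -> extracted_work rho H V <= M.
Proof.
have [b [b0 pb nb]] := hermitian_bound hH.
have addK := total_hamiltonian_additive H.
pose z : C := n%:R * b%:C%C.
have := additive_observable_le (additive_observable_opp addK) (z := b%:C%C).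
rewrite total_hamiltonian1 => /(_ nb n) pN.
exists (complex.Re (\tr (ntensmx rho n *m total_hamiltonian n H) + z)) => V uV.
apply: ler_complexRe; rewrite lerD2l.
have pV := psd_conj V (psd_ntens n prho).
have := mxtrace_psd_ge0 pV pN.
rewrite opprK mulmxDr mxtraceD mul_mx_scalar mxtraceZ mxtrace_mulC mulmxA unitarymxPl //.
rewrite mul1mx mxtrace_ntens trrho expr1n mulr1 => h.
by rewrite lerNl -subr_ge0 opprK addrC.
Qed.

Lemma extracted_work_le_sup n (S : set 'M[C]_(d ^ n)) V :
  (forall V, S V -> V \is unitarymx) -> S V ->
  extracted_work rho H V <= sup [set extracted_work rho H V | V in S]%classic.
Proof.
move=> uS SV; have [M hM] := extracted_work_bound n.
apply: ub_le_sup; last by exists V.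
by exists M => _ [W SW <-]; exact/hM/uS.
Qed.

Lemma max_work_inv_le (G : finGroupType) (U : G -> 'M[C]_d) n :
  max_work_inv U n rho H <= max_work n rho H.
Proof.
have [V [uV _] <-] := max_work_inv_attained U n rho H.
by apply: extracted_work_le_sup.
Qed.

Lemma extracted_work_le_inv (G : finGroupType) (U : G -> 'M[C]_d) n (V : 'M[C]_(d ^ n)) :
  V \is unitarymx -> (forall g, comm_mx V (ntensmx (U g) n)) ->
  extracted_work rho H V <= max_work_inv U n rho H.
Proof.
move=> uV cV; exact: (extracted_work_le_sup (fun W h => proj1 h) (conj uV cV)).
Qed.

Lemma extracted_work_scalar z n (V : 'M[C]_(d ^ n)) : rho = z%:M ->
  V \is unitarymx -> extracted_work rho H V = 0.
Proof.
move=> -> uV; rewrite /extracted_work ntensmx_scalar mul_mx_scalar -scalemxAl.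
by rewrite (unitarymxP uV) scalemx1 subrr.
Qed.

(** Both errors of the likelihood test decay like F^r, so a large r beats delta and also A #|G|, the
    factor #|G| being the price of making the projector invariant. *)
Lemma typical_projector (G : finGroupType) (U : G -> 'M[C]_d) (A : nat) (delta : R) :
  proj_rep U -> (forall z, rho != z%:M) -> 0 < delta ->
  exists r (P : 'M[C]_(d ^ r)), [/\ projector P,
    forall g, comm_mx P (ntensmx (U g) r), A%:R * \tr P <= (d ^ r)%:R &
    1 - delta%:C%C <= \tr (ntensmx rho r *m P)].
Proof.
move=> repU ns de0; have [F [F0 F1 test]] := likelihood_test prho trrho ns.
have FE : F = (complex.Re F)%:C%C by rewrite RRe_real // ger0_real.
set f := complex.Re F in FE; rewrite FE in F0 F1 test.
have {}F0 : 0 <= f by rewrite -lecR.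
have {}F1 : f < 1 by rewrite -ltcR.
(* The added 1 keeps B positive when A = 0. *)
pose B := (A%:R * #|G|%:R : R) + 1.
have B0 : 0 < B by rewrite ltr_wpDl // mulr_ge0.
have eps0 : 0 < Num.min delta B^-1 by rewrite lt_min de0 invr_gt0.
have nf : `|f| < 1 by rewrite ger0_norm.
have [r _ /(_ r (leqnn r)) /=] := cvgr0_norm_lt _ (cvg_expr nf) _ eps0.
rewrite ger0_norm ?exprn_ge0 // lt_min => /andP[fd fB].
have [P0 [pP0 trP0 errP0]] := test r.
have [P [pP PP0 trP cP]] := invariant_support (proj_rep_ntens repU r) pP0.
exists r, P; split=> //.
  have ABf : (A%:R * #|G|%:R * f ^+ r)%:C%C <= 1 :> C.
    rewrite (_ : 1 = 1%:C%C) // lecR; apply: (@le_trans _ _ (B * f ^+ r)).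
      by rewrite ler_wpM2r ?exprn_ge0 // lerDl.
    by rewrite -ler_pdivlMl // mulr1 ltW.
  apply: (@le_trans _ _ (A%:R * (#|G|%:R * (f%:C%C ^+ r * d%:R ^+ r)))).
    by rewrite ler_wpM2l // (le_trans trP) // ler_wpM2l.
  rewrite natrX !mulrA -[X in _ <= X]mul1r ler_wpM2r ?exprn_ge0 ?ler0n //.
  by move: ABf; rewrite !rmorphM !rmorph_nat rmorphXn.
apply: (@le_trans _ _ (\tr (ntensmx rho r *m P0))); last first.
  by apply: mxtrace_projector_le => //; exact: psd_ntens.
move: errP0; rewrite mulmxBr mulmx1 raddfB /= mxtrace_ntens trrho expr1n.
rewrite lerBlDl -lerBlDr; apply: le_trans; rewrite lerD2l lerN2 -rmorphXn lecR.
exact: ltW.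
Qed.

End Work.

(** * From an optimal block to the invariant rate *)

Section InvariantWork.
Variables (R : realType) (d : nat) (G : finGroupType).
Local Notation C := R[i].
Variables (U : G -> 'M[C]_d) (rho H : 'M[C]_d).
Hypotheses (repU : proj_rep U) (cH : forall g, comm_mx (U g) H).
Hypotheses (prho : psd rho) (trrho : \tr rho = 1) (hH : H^t* = H).

Lemma mxtrace_hermitian_real n (s K : 'M[C]_n) : s^t* = s -> K^t* = K ->
  \tr (s *m K) = (complex.Re (\tr (s *m K)))%:C%C.
Proof.
move=> hs hK; rewrite RRe_real //; apply/CrealP.
by rewrite -mxtrace_adj adjmxM hs hK mxtrace_mulC.
Qed.

(** Apply [finite_invariant_work] to an optimal unitary on n0 copies. Per block, eta and the failure
    term each cost at most eps / 2; the extra copies cost a constant M, independent of k. *)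
Lemma max_work_inv_ge n0 (eps : R) : (forall z, rho != z%:M) -> 0 < eps ->
  exists c k0 : nat, exists M : R, forall k, (k0 <= k)%N ->
    k%:R * (max_work n0 rho H - eps) - M <= max_work_inv U (k * n0 + c) rho H.
Proof.
move=> ns eps0; have [beta [b0 pb _]] := hermitian_bound hH.
pose K n := total_hamiltonian n H.
have addK : additive_observable K := total_hamiltonian_additive H.
have K1 : K 1%N = H := total_hamiltonian1 H.
have hK1 : (K 1%N)^t* = K 1%N by rewrite K1.
have cK g : comm_mx (U g : 'M[C]_(d ^ 1)) (K 1%N) by rewrite K1; exact: cH.
have hK := additive_observable_adj addK hK1.
have [W0 uW0 W0E] := max_work_attained n0 rho H.
pose s := W0 *m ntensmx rho n0 *m W0^t*.
have ps : psd s by apply: psd_conj; exact: psd_ntens.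
pose e := complex.Re (\tr (s *m K n0)).
have eE : \tr (s *m K n0) = e%:C%C.
  by apply: mxtrace_hermitian_real; [exact: (proj1 ps) | exact: hK].
pose B := K n0 - e%:C%C%:M.
have hB : B^t* = B.
  rewrite adjmxB hK tr_scalar_mx map_scalar_mx /= conj_Creal //.
  by rewrite complex_real.
have pBB : psd (B *m B) by rewrite -{2}hB; exact: psd_mul_adj.
have v0 := mxtrace_psd_ge0 ps pBB.
pose v := complex.Re (\tr (s *m (B *m B))).
have vE : \tr (s *m (B *m B)) = v%:C%C by rewrite RRe_real // ger0_real.
have {}v0 : 0 <= v by rewrite -lecR -vE.
pose h := complex.Re (\tr (rho *m H)).
have hE : \tr (rho *m H) = h%:C%C.
  by apply: mxtrace_hermitian_real => //; exact: (proj1 prho).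
have wE : max_work n0 rho H = n0%:R * h - e.
  rewrite -W0E /extracted_work mxtrace_total_hamiltonian // hE -/K -/s eE.
  by rewrite -(rmorph_nat (real_complex R)) -rmorphM -rmorphB.
(* The added 1 makes D a positive divisor; the bound 1 / 2 below ensures delta < 1. *)
pose D := `|n0%:R * beta - e| + 1; have D0 : 0 < D by rewrite ltr_wpDl.
pose delta := Num.min (1 / 2) (eps / (4 * D)).
have de0 : 0 < delta by rewrite lt_min !divr_gt0 // mulr_gt0.
have de1 : delta < 1 by rewrite gt_min; apply/orP; left; lra.
have deD : (n0%:R * beta - e) * (2 * delta) <= eps / 2.
  have dD : delta <= eps / (4 * D) by rewrite ge_min lexx orbT.
  apply: (@le_trans _ _ (D * (2 * (eps / (4 * D))))).
    apply: (@le_trans _ _ (D * (2 * delta))).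
      rewrite ler_wpM2r ?mulr_ge0 ?(ltW de0) //.
      by apply: le_trans (ler_norm _) _; rewrite lerDl.
    by rewrite ler_wpM2l ?(ltW D0) // ler_wpM2l.
  rewrite le_eqVlt; apply/orP; left; apply/eqP; field.
  by rewrite gt_eqF.
pose eta := eps / 2; have eta0 : 0 < eta by rewrite divr_gt0.
have [m [omega [oo oU]]] := reference_vector repU.
have [r [P [pP cP dimP trP]]] := typical_projector prho trrho (#|G| * d ^ m + 1) repU ns de0.
have deta : 0 < delta * eta ^+ 2 by rewrite mulr_gt0 // exprn_gt0.
(* From k0 blocks on, the Chebyshev error v / (k eta^2) is at most delta. *)
pose k0 := (Num.bound (v / (delta * eta ^+ 2))).+1.
(* Each of the r + m extra copies starts with mean energy h and is charged the maximal energy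
   beta. *)
exists (r + m)%N, k0, ((r + m)%:R * (beta - h)) => k k0k.
have kv : v <= delta * (k%:R * eta ^+ 2).
  rewrite mulrCA -ler_pdivrMr //; apply: (@le_trans _ _ k0%:R); last by rewrite ler_nat.
  rewrite ltW // (lt_le_trans (archi_boundP _)) ?divr_ge0 ?(ltW deta) //.
  by rewrite ler_nat.
have real_ (x : R) : x%:C%C \is Num.real by rewrite complex_real.
have pb1 : psd (beta%:C%C%:M - K 1%N) by rewrite K1.
have [] := @finite_invariant_work C G d U rho K repU prho trrho addK hK1 cK
  beta%:C%C e%:C%C v%:C%C eta%:C%C delta%:C%C n0 W0 m omega r P k pb1 uW0 eE vE
  (real_ _) (real_ _) oo oU pP cP.
- by move: dimP; rewrite natrD natrM.
- exact: trP.
- by rewrite ltcR.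
- by rewrite ltcR.
- by rewrite ltcR.
- exact: leq_trans k0k.
- have -> : delta%:C%C * (k%:R * eta%:C%C ^+ 2) = (delta * (k%:R * eta ^+ 2))%:C%C.
    by rewrite !expr2 !rmorphM rmorph_nat.
  by rewrite lecR.
move=> V [uV cV hV].
rewrite addnA; apply: le_trans (extracted_work_le_inv prho trrho hH uV cV).
pose q := k%:R * (e + eta + (n0%:R * beta - e) * (2 * delta)) + (r + m)%:R * beta.
have {}hV : complex.Re (\tr (V *m ntensmx rho (k * n0 + r + m) *m V^t* *m
    total_hamiltonian (k * n0 + r + m) H)) <= q.
  have qE (a b c : nat) (x y z w : R) : a%:R * (x%:C%C + y%:C%C +
      (b%:R * z%:C%C - x%:C%C) * (2 * w%:C%C)) + c%:R * z%:C%C =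
      (a%:R * (x + y + (b%:R * z - x) * (2 * w)) + c%:R * z)%:C%C.
    by rewrite !(rmorphD, rmorphM, rmorphN, rmorph_nat).
  by have := ler_complexRe hV; rewrite qE.
have -> : extracted_work rho H V = (k * n0 + r + m)%:R * h -
    complex.Re (\tr (V *m ntensmx rho (k * n0 + r + m) *m V^t* *m
    total_hamiltonian (k * n0 + r + m) H)).
  rewrite /extracted_work mxtrace_total_hamiltonian // hE.
  rewrite -(rmorph_nat (real_complex R)) -rmorphM.
  by case: (\tr (V *m _ *m _ *m _)).
apply: le_trans (lerB (lexx _) hV); rewrite /q wE !natrD natrM.
have hk : 0 <= k%:R * (eps / 2 - (n0%:R * beta - e) * (2 * delta)).
  by rewrite mulr_ge0 // subr_ge0.
rewrite -subr_ge0; apply: le_trans hk _; rewrite le_eqVlt; apply/orP; left; apply/eqP.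
by rewrite /eta; field.
Qed.

(** With n0 fixed and k growing, the c extra copies and the constant M are negligible against k *
    n0. *)
Lemma asymptotic_work_inv_ge n0 : (forall z, rho != z%:M) -> (0 < n0)%N ->
  ((n0%:R^-1 * max_work n0 rho H)%:E <= asymptotic_work_inv U rho H)%E.
Proof.
move=> ns n00; apply/lee_addgt0Pr => eps eps0; rewrite -leeBlDr // -EFinB.
set w := max_work n0 rho H.
have n0R : 0 < n0%:R :> R by rewrite ltr0n.
(* The loss is eps / 2 per copy, so the other half of eps is left to absorb c and M. *)
have [|c [k0 [M hM]]] := @max_work_inv_ge n0 (eps * n0%:R / 2) ns.
  by rewrite divr_gt0 // mulr_gt0.
apply: limn_esup_ge => n.
pose a := n0%:R^-1 * w - eps.
have en0 : 0 < eps * n0%:R / 2 by rewrite divr_gt0 // mulr_gt0.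
(* From k1 blocks on, that remaining half, k n0 eps / 2, dominates c a + M. *)
pose k1 := Num.bound (`|c%:R * a + M| / (eps * n0%:R / 2)).
pose k := (k0 + n + k1 + 1)%N; exists (k * n0 + c)%N.
  apply: leq_trans (leq_addr _ _); apply: leq_trans (leq_pmulr _ n00).
  by rewrite /k; lia.
have k0k : (k0 <= k)%N by rewrite /k; lia.
have N0 : 0 < (k * n0 + c)%:R :> R.
  by rewrite ltr0n ltn_addr // muln_gt0 n00 andbT /k addn1.
rewrite lee_fin -/a -(ler_pM2l N0) mulVKf ?gt_eqF //.
apply: le_trans (hM k k0k); rewrite -/w.
have hk : `|c%:R * a + M| <= k%:R * (eps * n0%:R / 2).
  rewrite -ler_pdivrMr //; apply: (@le_trans _ _ k1%:R).
    by rewrite ltW // archi_boundP // divr_ge0 // ltW.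
  by rewrite ler_nat /k; lia.
have {}hk := le_trans (ler_norm _) hk.
rewrite -subr_ge0 in hk; rewrite -subr_ge0; apply: le_trans hk _.
rewrite le_eqVlt; apply/orP; left; apply/eqP; rewrite natrD natrM /a.
by field; rewrite gt_eqF.
Qed.

End InvariantWork.

Theorem theorem14 (R : realType) (d : nat) (G : finGroupType)
    (U : G -> 'M[R[i]]_d) (H rho : 'M[R[i]]_d) :
  projective_unitary_rep U ->
  H \is hermsymmx ->
  (forall g : G, comm_mx (U g) H) ->
  density_matrix rho ->
  asymptotic_work_inv U rho H = asymptotic_work rho H.
Proof.
move=> [uU [om omU]] /is_hermitianmxP; rewrite expr0 scale1r => /esym hH cH.
move=> [/is_hermitianmxP + qrho trrho]; rewrite expr0 scale1r => /esym hrho.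
have prho : psd rho by split.
have repU : proj_rep U.
  by split=> // g h; have [w1 e] := omU g h; exists (om g h).
have [[z rhoz]|ns] := pselect (exists z, rho = z%:M).
  rewrite /asymptotic_work_inv /asymptotic_work; congr limn_esup.
  apply/funext => n; congr (_ * _)%:E.
  have [V [uV _] <-] := max_work_inv_attained U n rho H.
  have [W uW <-] := max_work_attained n rho H.
  by rewrite !(extracted_work_scalar _ rhoz).
have {}ns z : rho != z%:M by apply/eqP => e; apply: ns; exists z.
apply/eqP; rewrite eq_le; apply/andP; split.
  apply: le_limn_esup => n; rewrite lee_fin ler_wpM2l ?invr_ge0 //.
  exact: max_work_inv_le.
(* Each rate at positive n, not just the upper limit, is bounded by the invariant asymptotic
   rate. *)
apply: limn_esup_le => n n0; exact: asymptotic_work_inv_ge.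
Qed.
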